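(* (ZF + DC + $\mathrm{AC}_{<\mu}$) Let $\mu$ be a singular cardinal such that $\mu=\sup\{\lambda<\mu:\lambda\text{ is a measurable cardinal}\}$. Let $\bar\kappa=\langle\kappa_i:i<\mathrm{cf}(\mu)\rangle$ be increasing with limit $\mu$, with each $\kappa_i>\mathrm{cf}(\mu)$, such that $\kappa_i=(\sum\{\kappa_j:j<i\})^+$ for limit $i$ and $\kappa_i$ is measurable for non-limit $i$ ($0$ counts as non-limit). Define $\mathbf p=(\mathbb D,\mathrm{rk},\Sigma,\mathbf j,\mu)$ as follows. - $\mathbb D$ is the set of ideals $J$ such that the dual filter $\mathrm{dual}(J)$ is a non-principal $\kappa_0$-complete ultrafilter on some $\kappa=\kappa_J<\mu$; for $J\in\mathbb D$, $Y_J=\kappa_J$ and $D_J=\mathrm{dual}(J)$. - $\mathbf j(J)=\min\{i: J\text{ is not }\kappa_{i+1}^{+}\text{-complete}\}$ (this is well defined). - $\Sigma(J)=\{J\}$. - $\mathrm{rk}_J(f)=\mathrm{rk}_{\mathrm{dual}(J)}(f)$ for $f:\kappa_J\to\mathrm{Ord}$. Then $\mathbf p$ is a strict rank 1-system.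
   Context: The base theory is ZF. $\mathrm{AC}_X$ says that every family of non-empty sets indexed by $X$ has a choice function; $\mathrm{AC}_{<\mu}$ says that $\mathrm{AC}_\alpha$ holds for every $\alpha<\mu$. A filter is $\kappa$-complete if it is closed under intersections of fewer than $\kappa$ members; an ideal is $\kappa$-complete if its dual filter is; $\mathrm{dual}(J)=\{Y\setminus X:X\in J\}$ for an ideal $J$ on $Y$. Filters are proper. A cardinal $\lambda>\aleph_0$ is measurable if there is a $\lambda$-complete non-principal ultrafilter on $\lambda$. For a set $A$, $\theta(A)$ is the least (non-zero) ordinal $\alpha$ such that there is no function from $A$ onto $\alpha$. For a filter $D$ on $Y$ and $f,g:Y\to\mathrm{Ord}$, ''$f<g$ mod $D$'' (or $f<_D g$) means $\{s\in Y:f(s)<g(s)\}\in D$; similarly for $\le$, $=$. ${}^{Y}\mathrm{Ord}$ is the class of functions from $Y$ to the ordinals. For a filter $D$ on $Y$ and $f:Y\to\mathrm{Ord}$, $\mathrm{rk}_D(f)\in\mathrm{Ord}\cup\{\infty\}$ is defined by recursion: for an ordinal $\alpha$, $\mathrm{rk}_D(f)=\alpha$ iff $\mathrm{rk}_D(f)\neq\beta$ for all $\beta<\alpha$ and for every $g:Y\to\mathrm{Ord}$ with $g<_D f$ there is $\beta<\alpha$ with $\mathrm{rk}_D(g)=\beta$. Under DC the rank is an ordinal when $D$ is $\aleph_1$-complete. **Weak rank 1-system.** $\mathbf p=(\mathbb D,\mathrm{rk},\Sigma,\mathbf j,\mu)$ is a weak rank 1-system when: (a) $\mu$ is a singular cardinal.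 (b) Each $\mathbf d\in\mathbb D$ is (or determines) a pair $(Y_{\mathbf d},D_{\mathbf d})$, where $D_{\mathbf d}$ is a filter on the set $Y_{\mathbf d}$ and $\theta(Y_{\mathbf d})<\mu$. (c) For each $\mathbf d\in\mathbb D$, $\mathrm{rk}_{\mathbf d}$ is a (definable) function with domain ${}^{Y_{\mathbf d}}\mathrm{Ord}$ and values in $\mathrm{Ord}$. For an ordinal $\alpha$, $\mathrm{rk}_{\mathbf d}(\alpha)$ means $\mathrm{rk}_{\mathbf d}$ of the constant function $\alpha$ on $Y_{\mathbf d}$. (d) $\Sigma$ is a function with domain $\mathbb D$ with $\Sigma(\mathbf d)\subseteq\mathbb D$, and $Y_{\mathbf e}=Y_{\mathbf d}$ for $\mathbf e\in\Sigma(\mathbf d)$. (e) $\mathbf j$ is a function from $\mathbb D$ onto $\mathrm{cf}(\mu)$; $\mathbb D_{\ge i}:=\{\mathbf d\in\mathbb D:\mathbf j(\mathbf d)\ge i\}$; and $\mathbf e\in\Sigma(\mathbf d)$ implies $\mathbf j(\mathbf e)\ge\mathbf j(\mathbf d)$. (f) For every $\sigma<\mu$ there is $i<\mathrm{cf}(\mu)$ such that every $\mathbf d\in\mathbb D_{\ge i}$ is $(\mathbf p,\le\sigma)$-complete. Here $\mathbf d$ is $(\mathbf p,\le X)$-complete when: if $f\in{}^{Y_{\mathbf d}}\mathrm{Ord}$, $\zeta=\mathrm{rk}_{\mathbf d}(f)$ and $\langle A_j:j\in X\rangle$ is a partition of $Y_{\mathbf d}$, then for some $\mathbf e\in\Sigma(\mathbf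 d)$ and $j\in X$ we have $A_j\in D_{\mathbf e}$ and $\mathrm{rk}_{\mathbf e}(f)=\zeta$. (g) (no hole) If $\mathrm{rk}_{\mathbf d}(f)>\zeta$, then for some $\mathbf e\in\Sigma(\mathbf d)$ and $g$ we have $g<_{D_{\mathbf e}}f$ and $\mathrm{rk}_{\mathbf e}(g)=\zeta$. (h) If $f=g+1$ mod $D_{\mathbf d}$ then $\mathrm{rk}_{\mathbf d}(f)=\mathrm{rk}_{\mathbf d}(g)+1$. (i) If $f\le g$ mod $D_{\mathbf d}$ then $\mathrm{rk}_{\mathbf d}(f)\le\mathrm{rk}_{\mathbf d}(g)$. **Strict.** A strict rank 1-system is a weak rank 1-system that also satisfies: (j) For every $\mathbf d\in\mathbb D$, ordinals $\zeta,\xi$, function $f$ and $j_0$ satisfying - $f:Y_{\mathbf d}\to\xi$, $\mathrm{rk}_{\mathbf d}(f)=\zeta$, $\xi<\zeta$, $\mathrm{cf}(\zeta)=\mathrm{cf}(\mu)$, $j_0<\mathrm{cf}(\mu)$, and - $\mathrm{rk}_{\mathbf e'}(f(s))=f(s)$ for all $s\in Y_{\mathbf d}$ and $\mathbf e'\in\mathbb D_{\ge j_0}$, there is $j$ with $j_0\le j<\mathrm{cf}(\mu)$ such that there are no $\mathbf e,g$ with $\mathbf e\in\mathbb D_{\ge j}$, $g:Y_{\mathbf e}\to\zeta$, $\{g(t):t\in Y_{\mathbf e}\}\subseteq[\xi,\zeta_* )$ for some $\zeta_*<\zeta$, and $\mathrm{rk}_{\mathbf e}(g)\ge\zeta$.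 *)

(* Defs.v *)
(* The base theory is choiceless ZF, so the statement is about an arbitrary
   model of first-order ZF.  Separation and Replacement are restricted to
   formulas: with schemes ranging over all Rocq predicates, a choice operator in
   the metatheory would make every model satisfy full AC.  Models need not be
   well-founded externally, so all notions below (ordinals, functions, ...) are
   those of the model. *)

Set Implicit Arguments.
Unset Strict Implicit.

Record set_structure : Type := SetStructure {
  carrier :> Type;
  mem : carrier -> carrier -> Prop
}.
Arguments mem {s} x y.

Declare Scope zf_scope.
Delimit Scope zf_scope with zf.
Notation "x ∈ y" := (mem x y) (at level 70, no associativity) : zf_scope.
Notation "x ∉ y" := (~ mem x y) (at level 70, no associativity) : zf_scope.
Open Scope zf_scope.

(** * First-order formulas of set theory (de Bruijn variables) *)

Inductive formula : Type :=
  | FMem (i j : nat)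
  | FEq (i j : nat)
  | FBot
  | FImp (A B : formula)
  | FAnd (A B : formula)
  | FOr (A B : formula)
  | FAll (A : formula)
  | FEx (A : formula).

Definition scons {X : Type} (x : X) (rho : nat -> X) (n : nat) : X :=
  match n with O => x | S m => rho m end.

Fixpoint sat {V : set_structure} (rho : nat -> V) (A : formula) : Prop :=
  match A with
  | FMem i j => rho i ∈ rho j
  | FEq i j => rho i = rho j
  | FBot => False
  | FImp B C => sat rho B -> sat rho C
  | FAnd B C => sat rho B /\ sat rho C
  | FOr B C => sat rho B \/ sat rho C
  | FAll B => forall x : V, sat (scons x rho) B
  | FEx B => exists x : V, sat (scons x rho) B
  end.

(* Class relations of the model: definable by a formula with parameters. *)
Definition definable2 {V : set_structure} (R : V -> V -> Prop) : Prop :=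
  exists (A : formula) (rho : nat -> V),
    forall x y, R x y <-> sat (scons x (scons y rho)) A.

Definition definable3 {V : set_structure} (R : V -> V -> V -> Prop) : Prop :=
  exists (A : formula) (rho : nat -> V),
    forall x y z, R x y z <-> sat (scons x (scons y (scons z rho))) A.

(** * Basic set-theoretic vocabulary *)

Section Vocabulary.
Context {V : set_structure}.
Implicit Types (a b c p x y z f g h A B X Y D J S : V) (P : V -> Prop).

Definition is_empty a : Prop := forall x, x ∉ a.
Definition subset a b : Prop := forall x, x ∈ a -> x ∈ b.
Definition is_pair a b c : Prop := forall z, z ∈ c <-> z = a \/ z = b.
Definition is_opair a b p : Prop :=
  exists u v, is_pair a a u /\ is_pair a b v /\ is_pair u v p.
Definition is_succ a b : Prop := forall z, z ∈ b <-> z ∈ a \/ z = a.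
Definition is_diff Y X c : Prop := forall y, y ∈ c <-> y ∈ Y /\ y ∉ X.

(* Functions are sets of ordered pairs; [val f x y] says f(x) = y. *)
Definition val f x y : Prop := exists p, is_opair x y p /\ p ∈ f.
Definition is_fun f A : Prop :=
  (forall p, p ∈ f -> exists x y, x ∈ A /\ is_opair x y p) /\
  (forall x, x ∈ A -> exists! y, val f x y).
Definition maps f A B : Prop := is_fun f A /\ forall x y, val f x y -> y ∈ B.
Definition onto f A B : Prop :=
  maps f A B /\ forall y, y ∈ B -> exists x, val f x y.
Definition bijection f A B : Prop :=
  onto f A B /\ forall x x' y, val f x y -> val f x' y -> x = x'.
Definition equinumerous A B : Prop := exists f, bijection f A B.
Definition is_const f A a : Prop := is_fun f A /\ forall x y, val f x y -> y = a.

(** * Ordinals and cardinals *)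

Definition transitive a : Prop := forall x, x ∈ a -> subset x a.
(* Correct in the presence of the axiom of foundation. *)
Definition ordinal a : Prop := transitive a /\ forall x, x ∈ a -> transitive x.
Definition ole a b : Prop := a ∈ b \/ a = b.
Definition least P a : Prop := ordinal a /\ P a /\ forall b, b ∈ a -> ~ P b.
Definition is_sup P a : Prop :=
  ordinal a /\ (forall x, P x -> ole x a) /\
  forall b, ordinal b -> (forall x, P x -> ole x b) -> ole a b.
Definition limit_ordinal a : Prop :=
  ordinal a /\ ~ is_empty a /\ forall b, ~ is_succ b a.
Definition is_omega a : Prop := least limit_ordinal a.

Definition cardinal a : Prop :=
  ordinal a /\ forall b, b ∈ a -> ~ equinumerous b a.
Definition card_succ a b : Prop := least (fun c => cardinal c /\ a ∈ c) b.

Definition cofinal_map h c a : Prop :=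
  maps h c a /\ forall x, x ∈ a -> exists i y, val h i y /\ ole x y.
(* c = cf(a) *)
Definition is_cf a c : Prop := least (fun b => exists h, cofinal_map h b a) c.

Definition singular_cardinal a : Prop :=
  cardinal a /\ (exists w, is_omega w /\ ole w a) /\ exists c, is_cf a c /\ c ∈ a.

(* t = theta(A) *)
Definition is_theta A t : Prop :=
  least (fun a => ~ is_empty a /\ ~ exists f, onto f A a) t.

(** * Filters and ideals *)

Definition filter_on Y D : Prop :=
  (forall X, X ∈ D -> subset X Y) /\
  Y ∈ D /\
  (forall X, is_empty X -> X ∉ D) /\
  (forall X Z, X ∈ D -> subset X Z -> subset Z Y -> Z ∈ D) /\
  (forall X Z, X ∈ D -> Z ∈ D ->
     exists I, I ∈ D /\ forall y, y ∈ I <-> y ∈ X /\ y ∈ Z).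

Definition ultrafilter_on Y D : Prop :=
  filter_on Y D /\
  forall X, subset X Y -> X ∈ D \/ exists C, is_diff Y X C /\ C ∈ D.

Definition principal_filter Y D : Prop :=
  exists A, subset A Y /\ forall X, X ∈ D <-> subset X Y /\ subset A X.

(* |S| < k, for a cardinal k *)
Definition size_lt S k : Prop := exists a, a ∈ k /\ equinumerous S a.

Definition complete_filter Y D k : Prop :=
  forall S, subset S D -> size_lt S k ->
  exists I, I ∈ D /\ forall y, y ∈ I <-> y ∈ Y /\ forall X, X ∈ S -> y ∈ X.

Definition measurable a : Prop :=
  cardinal a /\ (exists w, is_omega w /\ w ∈ a) /\
  exists D, ultrafilter_on a D /\ ~ principal_filter a D /\ complete_filter a D a.

Definition ideal_on Y J : Prop :=
  (forall X, X ∈ J -> subset X Y) /\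
  (forall X, is_empty X -> X ∈ J) /\
  Y ∉ J /\
  (forall X Z, X ∈ J -> subset Z X -> Z ∈ J) /\
  (forall X Z, X ∈ J -> Z ∈ J ->
     exists U, U ∈ J /\ forall y, y ∈ U <-> y ∈ X \/ y ∈ Z).

(* D = dual(J) *)
Definition is_dual Y J D : Prop :=
  forall Z, Z ∈ D <-> exists X, X ∈ J /\ is_diff Y X Z.

Definition complete_ideal Y J k : Prop :=
  exists D, is_dual Y J D /\ complete_filter Y D k.

Definition ord_fun f Y : Prop := is_fun f Y /\ forall s a, val f s a -> ordinal a.

(* {s in Y : P s} belongs to D *)
Definition for_D_most Y D P : Prop :=
  exists A, A ∈ D /\ forall s, s ∈ A <-> s ∈ Y /\ P s.

Definition lt_mod Y D f g : Prop :=
  for_D_most Y D (fun s => exists a b, val f s a /\ val g s b /\ a ∈ b).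
Definition le_mod Y D f g : Prop :=
  for_D_most Y D (fun s => exists a b, val f s a /\ val g s b /\ ole a b).
(* f = g + 1 mod D *)
Definition eq_succ_mod Y D f g : Prop :=
  for_D_most Y D (fun s => exists a b, val f s a /\ val g s b /\ is_succ b a).

(* [R f a] is the class relation rk_D(f) = a (rk_D(f) is oo when no a
   satisfies it).  The recursion determines R among the definable relations,
   by induction on a inside the model; without definability it would not, in an
   externally ill-founded model. *)
Definition is_rank Y D (R : V -> V -> Prop) : Prop :=
  definable2 R /\
  forall f a, R f a <->
    ord_fun f Y /\ ordinal a /\
    (forall b, b ∈ a -> ~ R f b) /\
    (forall g, ord_fun g Y -> lt_mod Y D g f -> exists b, b ∈ a /\ R g b).

End Vocabulary.

(** * Axioms *)

Record ZF (V : set_structure) : Prop := {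
  zf_extensionality : forall a b : V, (forall x, x ∈ a <-> x ∈ b) -> a = b;
  zf_foundation : forall a : V, ~ is_empty a ->
    exists x, x ∈ a /\ forall y, y ∈ x -> y ∉ a;
  zf_pairing : forall a b : V, exists c, is_pair a b c;
  zf_union : forall a : V, exists u, forall x, x ∈ u <-> exists y, y ∈ a /\ x ∈ y;
  zf_power : forall a : V, exists p, forall x, x ∈ p <-> subset x a;
  zf_infinity : exists a : V, (exists e, is_empty e /\ e ∈ a) /\
    forall x, x ∈ a -> exists y, is_succ x y /\ y ∈ a;
  zf_separation : forall (A : formula) (rho : nat -> V) (a : V),
    exists b, forall x, x ∈ b <-> x ∈ a /\ sat (scons x rho) A;
  zf_replacement : forall (A : formula) (rho : nat -> V) (a : V),
    (forall x y y', x ∈ a -> sat (scons x (scons y rho)) A ->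
       sat (scons x (scons y' rho)) A -> y = y') ->
    exists b, forall y, y ∈ b <->
      exists x, x ∈ a /\ sat (scons x (scons y rho)) A
}.

Definition DC (V : set_structure) : Prop :=
  forall X R : V,
    ~ is_empty X -> (forall x, x ∈ X -> exists y, y ∈ X /\ val R x y) ->
    forall w, is_omega w ->
    exists f, maps f w X /\
      forall n m a b, is_succ n m -> val f n a -> val f m b -> val R a b.

Definition AC_on {V : set_structure} (X : V) : Prop :=
  forall F, is_fun F X -> (forall i a, val F i a -> ~ is_empty a) ->
  exists c, is_fun c X /\ forall i a z, val F i a -> val c i z -> z ∈ a.

Definition AC_lt {V : set_structure} (mu : V) : Prop :=
  forall a, a ∈ mu -> AC_on a.

(** * Rank systems *)

(* [DD], [Yof], [Dof], [Sig], [jj] are sets of the model, the last four being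
   functions with domain [DD]; [rk d f a] says rk_d(f) = a and is a class. *)
Record rank_data (V : set_structure) : Type := RankData {
  DD : V;
  Yof : V;
  Dof : V;
  rk : V -> V -> V -> Prop;
  Sig : V;
  jj : V;
  mu_of : V
}.

Section RankSystems.
Context {V : set_structure}.
Implicit Types (p : rank_data V) (d e f g i j X : V).

Definition in_Sig p e d : Prop := exists S, val (Sig p) d S /\ e ∈ S.

(* d belongs to DD_{>= i} *)
Definition in_DD_ge p i d : Prop := d ∈ DD p /\ exists k, val (jj p) d k /\ ole i k.

(* The pieces A_j may be empty. *)
Definition is_partition (A X Y : V) : Prop :=
  is_fun A X /\
  (forall y, y ∈ Y <-> exists j Aj, val A j Aj /\ y ∈ Aj) /\
  (forall j j' Aj Aj' y, val A j Aj -> val A j' Aj' -> y ∈ Aj -> y ∈ Aj' -> j = j').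

(* d is (p, <= X)-complete *)
Definition sys_complete p X d : Prop :=
  forall Y f zeta A,
    val (Yof p) d Y -> rk p d f zeta -> is_partition A X Y ->
    exists e j Aj De, in_Sig p e d /\ val A j Aj /\ val (Dof p) e De /\
      Aj ∈ De /\ rk p e f zeta.

(* rk_d(a) = b, where a stands for the constant function a on Y_d *)
Definition rk_const p d (a b : V) : Prop :=
  exists Y c, val (Yof p) d Y /\ is_const c Y a /\ rk p d c b.

Record weak_rank_1_system p : Prop := {
  wr_mu : singular_cardinal (mu_of p);
  wr_Yof : is_fun (Yof p) (DD p);
  wr_Dof : is_fun (Dof p) (DD p);
  wr_filter : forall d Y D, val (Yof p) d Y -> val (Dof p) d D -> filter_on Y D;
  wr_theta : forall d Y, val (Yof p) d Y -> exists t, is_theta Y t /\ t ∈ mu_of p;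
  wr_rk_definable : definable3 (rk p);
  wr_rk_dom : forall d f a, rk p d f a ->
    exists Y, val (Yof p) d Y /\ ord_fun f Y /\ ordinal a;
  wr_rk_total : forall d Y f, val (Yof p) d Y -> ord_fun f Y ->
    exists! a, rk p d f a;
  wr_Sig_fun : is_fun (Sig p) (DD p);
  wr_Sig_sub : forall d e, in_Sig p e d -> e ∈ DD p;
  wr_Sig_Y : forall d e Y, in_Sig p e d -> val (Yof p) d Y -> val (Yof p) e Y;
  wr_j_onto : forall c, is_cf (mu_of p) c -> onto (jj p) (DD p) c;
  wr_j_mono : forall d e i k, in_Sig p e d ->
    val (jj p) d i -> val (jj p) e k -> ole i k;
  wr_complete : forall c, is_cf (mu_of p) c -> forall sigma, sigma ∈ mu_of p ->
    exists i, i ∈ c /\ forall d, in_DD_ge p i d -> sys_complete p sigma d;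
  wr_no_hole : forall d f xi zeta, rk p d f xi -> zeta ∈ xi ->
    exists e g Y De, in_Sig p e d /\ val (Yof p) e Y /\ val (Dof p) e De /\
      lt_mod Y De g f /\ rk p e g zeta;
  wr_succ : forall d Y D f g a b, val (Yof p) d Y -> val (Dof p) d D ->
    eq_succ_mod Y D f g -> rk p d f a -> rk p d g b -> is_succ b a;
  wr_mono : forall d Y D f g a b, val (Yof p) d Y -> val (Dof p) d D ->
    le_mod Y D f g -> rk p d f a -> rk p d g b -> ole a b
}.

Record strict_rank_1_system p : Prop := {
  sr_weak : weak_rank_1_system p;
  sr_strict : forall c d Y f zeta xi j0,
    is_cf (mu_of p) c ->
    val (Yof p) d Y -> ordinal zeta -> ordinal xi ->
    maps f Y xi -> rk p d f zeta -> xi ∈ zeta -> is_cf zeta c -> j0 ∈ c ->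
    (forall s a e, val f s a -> in_DD_ge p j0 e -> rk_const p e a a) ->
    exists j, j ∈ c /\ ole j0 j /\
      ~ exists e Ye g zeta_star rho,
          in_DD_ge p j e /\ val (Yof p) e Ye /\ maps g Ye zeta /\
          zeta_star ∈ zeta /\
          (forall t x, val g t x -> ole xi x /\ x ∈ zeta_star) /\
          rk p e g rho /\ ole zeta rho
}.

(** * The system attached to a sequence of measurable cardinals *)

Implicit Types (mu cfmu kap : V).

(* s is the cardinal sum of the kap_j, j < i *)
Definition is_card_sum kap i (s : V) : Prop :=
  cardinal s /\
  exists U, (forall q, q ∈ U <->
               exists j k x, j ∈ i /\ val kap j k /\ x ∈ k /\ is_opair j x q) /\
    equinumerous U s.

Record kappa_sequence mu cfmu kap : Prop := {
  ks_fun : is_fun kap cfmu;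
  ks_increasing : forall i j k l, i ∈ j -> val kap i k -> val kap j l -> k ∈ l;
  ks_limit : is_sup (fun k => exists i, val kap i k) mu;
  ks_gt_cf : forall i k, val kap i k -> cfmu ∈ k;
  ks_at_limit : forall i k, val kap i k -> limit_ordinal i ->
    exists s, is_card_sum kap i s /\ card_succ s k;
  ks_at_nonlimit : forall i k, val kap i k -> ~ limit_ordinal i -> measurable k
}.

(* J belongs to DD, with kappa_J = k and dual(J) = D *)
Definition kappa_ideal mu kap (J k D : V) : Prop :=
  cardinal k /\ k ∈ mu /\ ideal_on k J /\ is_dual k J D /\
  ultrafilter_on k D /\ ~ principal_filter k D /\
  exists z k0, is_empty z /\ val kap z k0 /\ complete_filter k D k0.

(* J, an ideal on k, is not kap_{i+1}^+ -complete *)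
Definition incomplete_at kap (k J i : V) : Prop :=
  exists i1 l lplus, is_succ i i1 /\ val kap i1 l /\ card_succ l lplus /\
    ~ complete_ideal k J lplus.

Record measurable_system mu kap p : Prop := {
  ms_mu : mu_of p = mu;
  ms_DD : forall J, J ∈ DD p <-> exists k D, kappa_ideal mu kap J k D;
  ms_Yof : is_fun (Yof p) (DD p) /\
    forall J k, val (Yof p) J k <-> exists D, kappa_ideal mu kap J k D;
  ms_Dof : is_fun (Dof p) (DD p) /\
    forall J D, val (Dof p) J D <-> exists k, kappa_ideal mu kap J k D;
  ms_j : is_fun (jj p) (DD p) /\
    forall J i, val (jj p) J i <->
      exists k D, kappa_ideal mu kap J k D /\ least (incomplete_at kap k J) i;
  ms_Sig : is_fun (Sig p) (DD p) /\
    forall J S, val (Sig p) J S <-> J ∈ DD p /\ is_pair J J S;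
  ms_rk_definable : definable3 (rk p);
  ms_rk_dom : forall J f a, rk p J f a -> J ∈ DD p;
  ms_rk : forall J k D, kappa_ideal mu kap J k D -> is_rank k D (rk p J)
}.

End RankSystems.

(* Main.v *)
From Stdlib Require Import Classical ClassicalEpsilon Arith Lia Setoid.
Require Import Defs.

Set Implicit Arguments.
Unset Strict Implicit.

(** The theorem is about an arbitrary model, so every instance of separation,
    replacement, induction and minimization has to come with a formula.  Predicates
    of the metalanguage are therefore carried along with a proof that they are
    definable with parameters ([dfn]); definite descriptions of definable predicates
    ([the]) give definable terms, and [dfn_solve] finds the formulas by following
    the syntax.

    Modulo a filter that is closed under countable intersections, dependent
    choice makes the order of ordinal functions well-founded
    ([complete_well_founded]).  Below a fixed ordinal the functions form a set, and
    ranks are the values of the rank function of that set; they do not depend on the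
    bound because a function below [f] can be clipped to lie below [f] everywhere
    ([clip], [canonical_rank_mono]).  So ranks exist and the recursion determines
    them ([canonical_rank_is_rank], [is_rank_unique]).  The absence of holes,
    monotonicity and the successor rule are formal consequences of the recursion.
    A dual ideal determines its cardinal because its union is that cardinal, and its
    index says beyond which of the [kappa_i] it is complete; a partition into fewer
    pieces than that has a large piece.  A measure on [kappa_(i+1)] has index [i],
    so every index occurs.

    Strictness rests on comparing iterated ranks.  Let [D] be a filter on [Y] and [E]
    an ultrafilter on [Z] that is complete for intersections indexed by [Y].  For a
    matrix of ordinals with rows indexed by [Z] and columns by [Y], the [E]-rank of
    the [D]-ranks of the rows is at most the [D]-rank of the [E]-ranks of the columns
    ([rank_rank_le]).  Suppose that [rk_D(f) = zeta] and that each value [f(s)] is the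
    [E]-rank of the corresponding constant function.  Applied to the matrix all of
    whose rows are [f], the inequality says that the [E]-rank of the constant [zeta]
    is at most [zeta].  Hence every function with values below [zeta] has [E]-rank
    below [zeta], which excludes the configuration forbidden by strictness as soon
    as the index of [E] is so large that [E] is complete for [Y]. *)

Existing Class ZF.

(** * Definable predicates and definable terms *)

Section Definability.
Context {V : set_structure}.
Implicit Types (rho : nat -> V) (P Q : (nat -> V) -> Prop) (t u : (nat -> V) -> V).

Definition lookup rho (r : nat + V) : V :=
  match r with inl i => rho i | inr c => c end.

(** Each free variable of the formula is either bound to a variable of the
    environment or replaced by a parameter from the model. *)
Definition dfn P : Prop :=
  exists (A : formula) (r : nat -> nat + V),
    forall rho, P rho <-> sat (fun n => lookup rho (r n)) A.

Definition tl rho (n : nat) : V := rho (S n).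

Definition up (f : nat -> nat) (n : nat) : nat :=
  match n with O => O | S m => S (f m) end.

Fixpoint ren (f : nat -> nat) (A : formula) : formula :=
  match A with
  | FMem i j => FMem (f i) (f j)
  | FEq i j => FEq (f i) (f j)
  | FBot => FBot
  | FImp A B => FImp (ren f A) (ren f B)
  | FAnd A B => FAnd (ren f A) (ren f B)
  | FOr A B => FOr (ren f A) (ren f B)
  | FAll A => FAll (ren (up f) A)
  | FEx A => FEx (ren (up f) A)
  end.

Lemma sat_ren (A : formula) : forall f rho rho', (forall n, rho' n = rho (f n)) ->
  (sat rho (ren f A) <-> sat rho' A).
Proof.
  induction A as [i j|i j| |A IHA B IHB|A IHA B IHB|A IHA B IHB|A IHA|A IHA];
    intros f rho rho' H; simpl; rewrite ?H; try tauto;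
    try (rewrite (IHA f rho rho' H), (IHB f rho rho' H); tauto).
  - split; intros K x; eapply IHA; try apply K; intros [|n]; simpl; auto.
  - split; intros [x K]; exists x; eapply IHA; try apply K; intros [|n]; simpl; auto.
Qed.

Lemma sat_ext (A : formula) rho rho' : (forall n, rho n = rho' n) -> (sat rho A <-> sat rho' A).
Proof.
  intros H.
  rewrite <- (@sat_ren A (fun n => n) rho rho'), <- (@sat_ren A (fun n => n) rho rho);
    auto; tauto.
Qed.

Lemma dfn_iff P Q : (forall rho, P rho <-> Q rho) -> dfn P -> dfn Q.
Proof.
  intros H (A & r & HA). exists A, r. intros rho. rewrite <- H. apply HA.
Qed.

Lemma dfn_rename P (f : nat -> nat) : dfn P -> dfn (fun rho => P (fun n => rho (f n))).
Proof.
  intros (A & r & HA).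
  exists A, (fun n => match r n with inl i => inl (f i) | inr c => inr c end).
  intros rho. rewrite HA. apply sat_ext. intros n. destruct (r n); reflexivity.
Qed.

(** Interleaving the two substitutions lets two formulas share one. *)
Lemma dfn_binary (F : formula -> formula -> formula) (C : Prop -> Prop -> Prop) P Q :
  (forall A B rho, sat rho (F A B) <-> C (sat rho A) (sat rho B)) ->
  (forall a a' b b', (a <-> a') -> (b <-> b') -> (C a b <-> C a' b')) ->
  dfn P -> dfn Q -> dfn (fun rho => C (P rho) (Q rho)).
Proof.
  intros HF HC (A & r & HA) (B & s & HB).
  exists (F (ren (fun n => 2 * n) A) (ren (fun n => S (2 * n)) B)),
    (fun n => if Nat.even n then r (Nat.div2 n) else s (Nat.div2 n)).
  intros rho. rewrite HF. apply HC.
  - rewrite HA. symmetry. apply sat_ren. intros n.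
    rewrite Nat.even_even, Nat.div2_double. reflexivity.
  - rewrite HB. symmetry. apply sat_ren. intros n.
    replace (S (2 * n)) with (2 * n + 1) at 1 by lia.
    rewrite Nat.even_odd, Nat.div2_succ_double. reflexivity.
Qed.

Lemma dfn_and P Q : dfn P -> dfn Q -> dfn (fun rho => P rho /\ Q rho).
Proof. apply (@dfn_binary FAnd and); simpl; tauto. Qed.

Lemma dfn_or P Q : dfn P -> dfn Q -> dfn (fun rho => P rho \/ Q rho).
Proof. apply (@dfn_binary FOr or); simpl; tauto. Qed.

Lemma dfn_imp P Q : dfn P -> dfn Q -> dfn (fun rho => P rho -> Q rho).
Proof. apply (@dfn_binary FImp (fun a b => a -> b)); simpl; tauto. Qed.

Lemma dfn_const (C : Prop) : dfn (fun _ => C).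
Proof.
  destruct (classic C).
  - exists (FImp FBot FBot), (fun n => inl n). simpl. tauto.
  - exists FBot, (fun n => inl n). simpl. tauto.
Qed.

Lemma dfn_not P : dfn P -> dfn (fun rho => ~ P rho).
Proof. intros H. apply dfn_imp; auto. apply dfn_const. Qed.

Lemma dfn_equiv P Q : dfn P -> dfn Q -> dfn (fun rho => P rho <-> Q rho).
Proof. intros. apply dfn_and; apply dfn_imp; auto. Qed.

Lemma dfn_quantifier (F : formula -> formula) (C : (V -> Prop) -> Prop)
  (P : (nat -> V) -> V -> Prop) :
  (forall A rho, sat rho (F A) <-> C (fun x => sat (scons x rho) A)) ->
  (forall a a', (forall x, a x <-> a' x) -> (C a <-> C a')) ->
  dfn (fun rho => P (tl rho) (rho 0)) -> dfn (fun rho => C (P rho)).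
Proof.
  intros HF HC (A & r & HA).
  (* Variable 0 stays bound; everything else moves one place up. *)
  exists (F (ren (fun n => match r n with inl 0 => 0 | _ => S n end) A)),
    (fun n => match r n with inl (S i) => inl i | inl 0 => inl 0 | inr c => inr c end).
  intros rho. rewrite HF. apply HC. intros x.
  rewrite (@sat_ren A _ _ (fun n => lookup (scons x rho) (r n))).
  - exact (HA (scons x rho)).
  - intros n. destruct (r n) as [[|i]|c] eqn:E; simpl; rewrite ?E; reflexivity.
Qed.

Lemma dfn_all (P : (nat -> V) -> V -> Prop) :
  dfn (fun rho => P (tl rho) (rho 0)) -> dfn (fun rho => forall x, P rho x).
Proof.
  apply (@dfn_quantifier FAll (fun a => forall x, a x)); simpl; try tauto.
  intros a a' H. split; intros K x; apply H; apply K.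
Qed.

Lemma dfn_ex (P : (nat -> V) -> V -> Prop) :
  dfn (fun rho => P (tl rho) (rho 0)) -> dfn (fun rho => exists x, P rho x).
Proof.
  apply (@dfn_quantifier FEx (fun a => exists x, a x)); simpl; try tauto.
  intros a a' H. split; intros [x K]; exists x; apply H; apply K.
Qed.

Definition dterm t : Prop := dfn (fun rho => rho 0 = t (tl rho)).

Lemma dterm_var (i : nat) : dterm (fun rho => rho i).
Proof. exists (FEq 0 1), (fun n => match n with 0 => inl 0 | _ => inl (S i) end). simpl. tauto. Qed.

Lemma dterm_param (c : V) : dterm (fun _ => c).
Proof. exists (FEq 0 1), (fun n => match n with 0 => inl 0 | _ => inr c end). simpl. tauto. Qed.

Lemma dterm_weaken t : dterm t -> dterm (fun rho => t (tl rho)).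
Proof.
  intros H. apply (dfn_rename (fun n => match n with 0 => 0 | S m => S (S m) end)) in H.
  exact H.
Qed.

Lemma dfn_subst (P : (nat -> V) -> V -> Prop) t :
  dfn (fun rho => P (tl rho) (rho 0)) -> dterm t -> dfn (fun rho => P rho (t rho)).
Proof.
  intros HP Ht. apply (@dfn_iff (fun rho => exists x, x = t rho /\ P rho x)).
  - intros rho. split; [intros (x & -> & K); exact K | intros K; exists (t rho); auto].
  - apply (@dfn_ex (fun rho x => x = t rho /\ P rho x)). apply dfn_and; auto.
Qed.

Lemma dfn_subst2 (R : V -> V -> Prop) t u :
  dfn (fun rho => R (rho 0) (rho 1)) -> dterm t -> dterm u ->
  dfn (fun rho => R (t rho) (u rho)).
Proof.
  intros HR Ht Hu. apply (@dfn_subst (fun rho x => R (t rho) x)); auto.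
  apply (@dfn_subst (fun rho x => R x (rho 0))); [|apply dterm_weaken; exact Ht].
  exact HR.
Qed.

Lemma dfn_subst3 (R : V -> V -> V -> Prop) t u v :
  dfn (fun rho => R (rho 0) (rho 1) (rho 2)) -> dterm t -> dterm u -> dterm v ->
  dfn (fun rho => R (t rho) (u rho) (v rho)).
Proof.
  intros HR Ht Hu Hv. apply (@dfn_subst (fun rho x => R (t rho) (u rho) x)); auto.
  apply (@dfn_subst (fun rho x => R (t (tl rho)) x (rho 0))); [|apply dterm_weaken; exact Hu].
  apply (@dfn_subst (fun rho x => R x (rho 0) (rho 1)));
    [exact HR | apply (@dterm_weaken (fun rho => t (tl rho))), dterm_weaken; exact Ht].
Qed.

Lemma dterm_subst (F : V -> V) t :
  dterm (fun rho => F (rho 0)) -> dterm t -> dterm (fun rho => F (t rho)).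
Proof.
  intros HF Ht. unfold dterm.
  apply (@dfn_subst (fun rho x => rho 0 = F x)); [|apply dterm_weaken; exact Ht].
  exact (dfn_rename (fun n => match n with 0 => 1 | 1 => 0 | S (S m) => S (S m) end) HF).
Qed.

Lemma dfn_mem t u : dterm t -> dterm u -> dfn (fun rho => mem (t rho) (u rho)).
Proof.
  apply dfn_subst2. exists (FMem 0 1), (fun n => inl n). simpl. tauto.
Qed.

Lemma dfn_eq t u : dterm t -> dterm u -> dfn (fun rho => t rho = u rho).
Proof.
  apply dfn_subst2. exists (FEq 0 1), (fun n => inl n). simpl. tauto.
Qed.

Lemma definable2_dfn (R : V -> V -> Prop) : definable2 R -> dfn (fun rho => R (rho 0) (rho 1)).
Proof.
  intros (A & rho0 & HA).
  exists A, (fun n => match n with 0 => inl 0 | 1 => inl 1 | S (S n) => inr (rho0 n) end).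
  intros rho. rewrite HA. apply sat_ext. intros [|[|n]]; reflexivity.
Qed.

Lemma definable3_dfn (R : V -> V -> V -> Prop) :
  definable3 R -> dfn (fun rho => R (rho 0) (rho 1) (rho 2)).
Proof.
  intros (A & rho0 & HA).
  exists A, (fun n => match n with 0 => inl 0 | 1 => inl 1 | 2 => inl 2
                                 | S (S (S n)) => inr (rho0 n) end).
  intros rho. rewrite HA. apply sat_ext. intros [|[|[|n]]]; reflexivity.
Qed.

(** In the other direction, the remaining variables are fixed to a point [b]; one
    formula then serves for up to three arguments, with the parameters placed in the
    environment after them. *)
Lemma dfn_sat P (b : V) : dfn P -> exists A s, forall x y z,
  P (scons x (scons y (scons z (fun _ => b)))) <-> sat (scons x (scons y (scons z s))) A.
Proof.
  intros (A & r & HA).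
  exists (ren (fun n => match r n with inl 0 => 0 | inl 1 => 1 | inl 2 => 2 | inl _ => 3 | inr _ => 4 + n end) A),
    (fun n => match n with 0 => b | S m => lookup (fun _ => b) (r m) end).
  intros x y z. rewrite HA. symmetry. apply sat_ren. intros n.
  destruct (r n) as [[|[|[|i]]]|c] eqn:E; simpl; rewrite ?E; reflexivity.
Qed.

Lemma dfn_definable2 (b : V) (R : V -> V -> Prop) :
  dfn (fun rho => R (rho 0) (rho 1)) -> definable2 R.
Proof.
  intros H. destruct (dfn_sat b H) as (A & s & HA).
  exists A, (scons b s). intros x y. rewrite <- HA. reflexivity.
Qed.

Lemma dfn_definable3 (b : V) (R : V -> V -> V -> Prop) :
  dfn (fun rho => R (rho 0) (rho 1) (rho 2)) -> definable3 R.
Proof. intros H. destruct (dfn_sat b H) as (A & s & HA). exists A, s. exact HA. Qed.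

End Definability.

(** * Set-theoretic terms *)

Section Terms.
Context {V : set_structure} {hZF : ZF V}.
Implicit Types (P : V -> Prop) (F : V -> V).

Lemma carrier_inhabited : inhabited V.
Proof. destruct (zf_infinity hZF) as [a _]. exact (inhabits a). Qed.

Definition unique_such P (y : V) : Prop := P y /\ forall z, P z -> z = y.

(** The value is the empty set when [P] has no unique witness, so that the
    description of a definable predicate is always a definable term. *)
Definition the P : V :=
  epsilon carrier_inhabited (fun y =>
    unique_such P y \/ (~ (exists x, unique_such P x) /\ is_empty y)).

Lemma extensionality (a b : V) : (forall x, mem x a <-> mem x b) -> a = b.
Proof. apply (zf_extensionality hZF). Qed.

Lemma empty_exists : exists e : V, is_empty e.
Proof. destruct (zf_infinity hZF) as (a & (e & H & _) & _). eauto. Qed.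

Lemma empty_unique (a b : V) : is_empty a -> is_empty b -> a = b.
Proof. intros Ha Hb. apply extensionality. intros x. specialize (Ha x). specialize (Hb x). tauto. Qed.

Lemma the_spec P (y : V) :
  y = the P <-> unique_such P y \/ (~ (exists x, unique_such P x) /\ is_empty y).
Proof.
  assert (E : exists y, unique_such P y \/ (~ (exists x, unique_such P x) /\ is_empty y)).
  { destruct (classic (exists x, unique_such P x)) as [[x H]|H]; [eauto|].
    destruct empty_exists as [e He]. eauto. }
  pose proof (epsilon_spec carrier_inhabited _ E) as K.
  split; [intros ->; exact K|].
  fold (the P) in K. unfold unique_such in *.
  intros [[H1 H2]|[H1 H2]]; destruct K as [[K1 K2]|[K1 K2]].
  - auto.
  - destruct K1. eauto.
  - destruct H1. eauto.
  - apply empty_unique; auto.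
Qed.

Lemma the_unique P y : P y -> (forall z, P z -> z = y) -> the P = y.
Proof. intros. symmetry. apply the_spec. left. split; auto. Qed.

Lemma the_sat P : (exists y, P y) -> (forall y z, P y -> P z -> y = z) -> P (the P).
Proof. intros [y Hy] H. rewrite (@the_unique P y); auto. Qed.

(** The graph of [the] is expressed by the two clauses of [the_spec]. *)
Lemma dterm_the (P : (nat -> V) -> V -> Prop) :
  dfn (fun rho => P (tl rho) (rho 0)) -> dterm (fun rho => the (P rho)).
Proof.
  intros H. unfold dterm.
  eapply dfn_iff; [intros rho; symmetry; apply the_spec|].
  assert (U : dfn (fun rho => unique_such (P (tl rho)) (rho 0))).
  { apply dfn_and; [exact H|].
    apply (@dfn_all _ (fun rho z => P (tl rho) z -> z = rho 0)). apply dfn_imp.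
    - exact (@dfn_rename _ _ (fun n => match n with 0 => 0 | S m => S (S m) end) H).
    - exact (dfn_eq (dterm_var 0) (dterm_var 1)). }
  apply dfn_or; [exact U|]. apply dfn_and.
  - apply dfn_not. apply (@dfn_ex _ (fun rho x => unique_such (P (tl rho)) x)).
    exact (@dfn_rename _ _ (fun n => match n with 0 => 0 | S m => S (S m) end) U).
  - apply (@dfn_all _ (fun rho x => ~ mem x (rho 0))). apply dfn_not.
    exact (dfn_mem (dterm_var 0) (dterm_var 1)).
Qed.

Definition empty : V := the (@is_empty V).
Definition upair (a b : V) : V := the (is_pair a b).
Definition opair (a b : V) : V := upair (upair a a) (upair a b).
Definition union (a : V) : V := the (fun u => forall x, mem x u <-> exists y, mem y a /\ mem x y).
Definition power (a : V) : V := the (fun p => forall x, mem x p <-> subset x a).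
Definition sep (a : V) P : V := the (fun b => forall x, mem x b <-> mem x a /\ P x).
Definition repl (a : V) F : V := the (fun b => forall y, mem y b <-> exists x, mem x a /\ y = F x).
Definition succ (a : V) : V := union (upair a (upair a a)).
Definition lam (a : V) F : V := repl a (fun x => opair x (F x)).
Definition app (f x : V) : V := the (fun y => val f x y).

End Terms.

Ltac dfn_fold := cbv beta delta [tl].

(** The hypotheses matched at the end cover relations and functions that are
    variables of the context. *)
Ltac dfn_step :=
  match goal with
  | |- dfn (fun _ => ?C) => apply (dfn_const C)
  | |- dfn (fun rho => forall x, @?P rho x) =>
      lazymatch type of P with
      | _ -> carrier _ -> Prop => apply (@dfn_all _ P); dfn_fold
      end
  | |- dfn (fun rho => exists x, @?P rho x) => apply (@dfn_ex _ P); dfn_fold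
  | |- dfn (fun rho => @?P rho -> @?Q rho) => apply (@dfn_imp _ P Q)
  | |- dfn (fun rho => @?P rho /\ @?Q rho) => apply (@dfn_and _ P Q)
  | |- dfn (fun rho => @?P rho \/ @?Q rho) => apply (@dfn_or _ P Q)
  | |- dfn (fun rho => ~ @?P rho) => apply (@dfn_not _ P)
  | |- dfn (fun rho => @?P rho <-> @?Q rho) => apply (@dfn_equiv _ P Q)
  | |- dfn (fun rho => @mem _ (@?t rho) (@?u rho)) => apply (@dfn_mem _ t u)
  | |- dfn (fun rho => @?t rho = @?u rho) => apply (@dfn_eq _ t u)
  | |- dterm (fun rho => rho ?i) => apply (dterm_var i)
  | |- dterm (fun _ => ?c) => apply (dterm_param c)
  | |- dterm (fun rho => the (@?P rho)) => apply (@dterm_the _ _ P); dfn_fold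
  | H : definable2 ?R |- dfn (fun rho => ?R (@?t rho) (@?u rho)) =>
      apply (@dfn_subst2 _ R t u (definable2_dfn H))
  | H : definable3 ?R |- dfn (fun rho => ?R (@?t rho) (@?u rho) (@?v rho)) =>
      apply (@dfn_subst3 _ R t u v (definable3_dfn H))
  | H : dfn (fun rho => ?R (rho 0) (rho 1)) |- dfn (fun rho => ?R (@?t rho) (@?u rho)) =>
      apply (@dfn_subst2 _ R t u H)
  | H : dfn (fun rho => ?R (rho 0)) |- dfn (fun rho => ?R (@?t rho)) =>
      apply (@dfn_subst _ (fun _ x => R x) t H)
  | H : dterm (fun rho => ?F (rho 0)) |- dterm (fun rho => ?F (@?t rho)) =>
      apply (@dterm_subst _ F t H)
  end.

Ltac dfn_unfold :=
  progress (unfold unique_such, unique, is_empty, subset, is_pair, is_succ, is_diff, is_opair, app, lam, repl, sep,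
    power, union, succ, upair, empty; cbv beta).

(** Closure lemmas proved later are added by redefining this tactic. *)
Ltac dfn_lemma := fail.

Ltac dfn_solve := solve [cbv beta; repeat first [assumption | dfn_step | dfn_lemma | dfn_unfold]].

Section SetOperations.
Context {V : set_structure} {hZF : ZF V}.
Implicit Types (P : V -> Prop) (F : V -> V).

Lemma upair_spec a b : is_pair a b (upair a b).
Proof.
  apply (the_sat (P := is_pair a b)); [apply (zf_pairing hZF)|].
  intros y z Hy Hz. apply extensionality. intros x. rewrite (Hy x), (Hz x). tauto.
Qed.

Lemma in_upair a b x : mem x (upair a b) <-> x = a \/ x = b.
Proof. apply upair_spec. Qed.

Lemma is_pair_eq a b c : is_pair a b c <-> c = upair a b.
Proof.
  split; [|intros ->; apply upair_spec].
  intros H. apply extensionality. intros x. rewrite in_upair. apply H.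
Qed.

Lemma is_opair_eq a b p : is_opair a b p <-> p = opair a b.
Proof.
  unfold is_opair, opair. split.
  - intros (u & v & Hu & Hv & Hp). apply is_pair_eq in Hu, Hv, Hp. congruence.
  - intros ->. exists (upair a a), (upair a b). repeat split; apply upair_spec.
Qed.

Lemma opair_inj a b a' b' : opair a b = opair a' b' -> a = a' /\ b = b'.
Proof.
  unfold opair. intros H.
  assert (U : forall x y z w, @upair V hZF x y = upair z w -> (x = z \/ x = w) /\ (y = z \/ y = w)
     /\ (z = x \/ z = y) /\ (w = x \/ w = y)).
  { intros x y z w E. rewrite <- !in_upair, <- E, !in_upair.
    assert (mem z (upair x y) /\ mem w (upair x y)) by (rewrite E, !in_upair; auto).
    rewrite !in_upair in H0. tauto. }
  destruct (U _ _ _ _ H) as (H1 & H2 & H3 & H4).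
  assert (a = a') as <-.
  { destruct H1 as [E|E]; apply U in E; intuition congruence. }
  split; [reflexivity|].
  destruct H2 as [E|E]; apply U in E; destruct E as (E1 & E2 & E3 & E4);
    destruct H4 as [E'|E']; apply U in E'; destruct E' as (F1 & F2 & F3 & F4);
    destruct E2, E4, F2, F4; congruence.
Qed.

Lemma val_opair (f x y : V) : val f x y <-> mem (opair x y) f.
Proof.
  unfold val. split.
  - intros (p & Hp & H). apply is_opair_eq in Hp. congruence.
  - intros H. exists (opair x y). split; [apply is_opair_eq; reflexivity | exact H].
Qed.

Lemma in_union a x : mem x (union a) <-> exists y, mem y a /\ mem x y.
Proof.
  revert x. apply the_sat with (P := fun u => forall x, mem x u <-> _); [apply (zf_union hZF)|].
  intros y z Hy Hz. apply extensionality. intros x. rewrite (Hy x), (Hz x). tauto.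
Qed.

Lemma in_power a x : mem x (power a) <-> subset x a.
Proof.
  revert x. apply the_sat with (P := fun u => forall x, mem x u <-> _); [apply (zf_power hZF)|].
  intros y z Hy Hz. apply extensionality. intros x. rewrite (Hy x), (Hz x). tauto.
Qed.

Lemma in_sep P a x : dfn (fun rho => P (rho 0)) -> (mem x (sep a P) <-> mem x a /\ P x).
Proof.
  intros H. revert x. apply the_sat with (P := fun u => forall x, mem x u <-> _).
  - destruct (dfn_sat a (dfn_rename (fun _ => 0) H)) as (A & s & HA).
    destruct (zf_separation hZF A (scons a (scons a s)) a) as [b Hb].
    exists b. intros x. rewrite Hb, <- HA. reflexivity.
  - intros y z Hy Hz. apply extensionality. intros x. rewrite (Hy x), (Hz x). tauto.
Qed.

Lemma in_repl F a y : dterm (fun rho => F (rho 0)) ->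
  (mem y (repl a F) <-> exists x, mem x a /\ y = F x).
Proof.
  intros H. revert y. apply the_sat with (P := fun u => forall x, mem x u <-> _).
  - assert (K : dfn (fun rho => rho 1 = F (rho 0))).
    { apply dfn_eq; [apply dterm_var | exact H]. }
    destruct (dfn_sat a K) as (A & s & HA).
    destruct (@zf_replacement V hZF A (scons a s) a) as [b Hb].
    + intros x y y' _ H1 H2. apply HA in H1, H2. cbn in H1, H2. congruence.
    + exists b. intros y. rewrite Hb.
      split; intros (x & Hx & E); exists x; (split; [exact Hx|]); apply (HA x y a); exact E.
  - intros y z Hy Hz. apply extensionality. intros x. rewrite (Hy x), (Hz x). tauto.
Qed.

Lemma empty_spec : is_empty (empty : V).
Proof. apply (the_sat (P := @is_empty V)); [exact empty_exists | intros; apply empty_unique; auto]. Qed.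

Lemma in_succ a x : mem x (succ a) <-> mem x a \/ x = a.
Proof.
  unfold succ. rewrite in_union. split.
  - intros (y & Hy & Hx). apply in_upair in Hy. destruct Hy as [->| ->]; auto.
    apply in_upair in Hx. tauto.
  - intros [H| ->].
    + exists a. rewrite in_upair. auto.
    + exists (upair a a). rewrite !in_upair. auto.
Qed.

Lemma is_succ_eq a b : is_succ a b <-> b = succ a.
Proof.
  split.
  - intros H. apply extensionality. intros x. rewrite in_succ. apply H.
  - intros -> x. apply in_succ.
Qed.

Lemma is_empty_not (a : V) : ~ is_empty a -> exists x, mem x a.
Proof. intros H. apply NNPP. intros K. apply H. intros x Hx. eauto. Qed.

(** ** Functions *)

Lemma val_functional (f A x y z : V) : is_fun f A -> val f x y -> val f x z -> y = z.
Proof.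
  intros [H1 H2] Hy Hz.
  assert (K : mem x A).
  { destruct Hy as (p & Hp & Hpf). destruct (H1 p Hpf) as (x' & y' & Hx & E).
    apply is_opair_eq in Hp, E. rewrite Hp in E. apply opair_inj in E. destruct E; congruence. }
  destruct (H2 x K) as (w & _ & Hw). rewrite <- (Hw y), <- (Hw z); auto.
Qed.

Lemma val_dom (f A x y : V) : is_fun f A -> val f x y -> mem x A.
Proof.
  intros [H1 H2] (p & Hp & Hpf). destruct (H1 p Hpf) as (x' & y' & Hx & E).
  apply is_opair_eq in Hp, E. rewrite Hp in E. apply opair_inj in E. destruct E; congruence.
Qed.

Lemma app_val (f A x : V) : is_fun f A -> mem x A -> val f x (app f x).
Proof.
  intros Hf Hx. apply (the_sat (P := fun y => val f x y)).
  - destruct (proj2 Hf x Hx) as (y & Hy & _). eauto.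
  - intros y z. apply (val_functional Hf).
Qed.

Lemma val_app (f A x y : V) : is_fun f A -> (val f x y <-> mem x A /\ y = app f x).
Proof.
  intros Hf. split.
  - intros H. assert (Hx := val_dom Hf H). split; [exact Hx|].
    exact (val_functional Hf H (app_val Hf Hx)).
  - intros [Hx ->]. exact (app_val Hf Hx).
Qed.

Lemma fun_ext (f g A : V) : is_fun f A -> is_fun g A ->
  (forall x, mem x A -> app f x = app g x) -> f = g.
Proof.
  assert (K : forall f g, is_fun f A -> is_fun g A ->
     (forall x, mem x A -> app f x = app g x) -> subset f g).
  { clear f g. intros f g Hf Hg H p Hp.
    destruct (proj1 Hf p Hp) as (x & y & Hx & E). apply is_opair_eq in E. subst p.
    apply val_opair. apply (val_app _ _ Hg). split; [exact Hx|].
    rewrite <- H by exact Hx. apply val_opair in Hp. apply (val_app _ _ Hf) in Hp. tauto. }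
  intros Hf Hg H. apply extensionality. intros x. split; apply K; auto.
  intros; symmetry; auto.
Qed.

Lemma val_lam F a x y : dterm (fun rho => F (rho 0)) -> (val (lam a F) x y <-> mem x a /\ y = F x).
Proof.
  intros H. rewrite val_opair. unfold lam, opair. rewrite in_repl by dfn_solve.
  split.
  - intros (z & Hz & E). apply opair_inj in E. destruct E as [-> ->]. auto.
  - intros [Hx ->]. eauto.
Qed.

Lemma lam_fun F a : dterm (fun rho => F (rho 0)) -> is_fun (lam a F) a.
Proof.
  intros H. split.
  - intros p Hp. unfold lam, opair in Hp. rewrite in_repl in Hp by dfn_solve.
    destruct Hp as (x & Hx & ->). exists x, (F x). split; [exact Hx|]. apply is_opair_eq. reflexivity.
  - intros x Hx. exists (F x). split; [apply val_lam; auto|].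
    intros y Hy. apply (val_lam _ _ _ H) in Hy. destruct Hy; congruence.
Qed.

Lemma app_lam F a x : dterm (fun rho => F (rho 0)) -> mem x a -> app (lam a F) x = F x.
Proof.
  intros H Hx. pose proof (app_val (lam_fun a H) Hx) as K. apply (val_lam _ _ _ H) in K. tauto.
Qed.

End SetOperations.

(** * Definability of the vocabulary *)

Section VocabularyDefinability.
Context {V : set_structure} {hZF : ZF V}.
Implicit Types (t u v : (nat -> V) -> V).

Lemma dterm_opair t u : dterm t -> dterm u -> dterm (fun rho => opair (t rho) (u rho)).
Proof.
  intros Ht Hu. unfold dterm. apply (@dfn_subst3 _ (fun a b c => a = opair b c) (fun rho => rho 0)).
  - unfold opair. dfn_solve.
  - apply dterm_var.
  - apply dterm_weaken, Ht.
  - apply dterm_weaken, Hu.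
Qed.

Lemma dfn_val t u v : dterm t -> dterm u -> dterm v -> dfn (fun rho => val (t rho) (u rho) (v rho)).
Proof.
  apply dfn_subst3. unfold val, is_opair. dfn_solve.
Qed.

Lemma dterm_app t u : dterm t -> dterm u -> dterm (fun rho => app (t rho) (u rho)).
Proof.
  intros Ht Hu. unfold dterm. apply (@dfn_subst3 _ (fun a b c => a = app b c) (fun rho => rho 0)).
  - apply dfn_eq; [apply dterm_var|]. apply (@dterm_the _ _ (fun rho y => val (rho 1) (rho 2) y)).
    apply dfn_val; dfn_fold; dfn_solve.
  - apply dterm_var.
  - apply dterm_weaken, Ht.
  - apply dterm_weaken, Hu.
Qed.

End VocabularyDefinability.

Ltac dfn_lemma ::=
  match goal with
  | |- dterm (fun rho => opair (@?t rho) (@?u rho)) => apply (dterm_opair (t := t) (u := u))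
  | |- dterm (fun rho => app (@?t rho) (@?u rho)) => apply (dterm_app (t := t) (u := u))
  | |- dfn (fun rho => val (@?t rho) (@?u rho) (@?v rho)) => apply (dfn_val (t := t) (u := u) (v := v))
  | _ => progress (unfold is_fun, maps, onto, bijection, equinumerous, is_const, transitive, ordinal,
      ole, least, is_sup, limit_ordinal, is_omega, cardinal, card_succ, cofinal_map, is_cf,
      filter_on, ultrafilter_on, principal_filter, size_lt, complete_filter, measurable,
      ideal_on, is_dual, complete_ideal, ord_fun, for_D_most, lt_mod, le_mod; cbv beta)
  end.

(** * Ordinals *)

Section Ordinals.
Context {V : set_structure} {hZF : ZF V}.
Implicit Types (a b c x y : V) (P : V -> Prop).

Lemma mem_irrefl a : ~ mem a a.
Proof.
  intros H. destruct (@zf_foundation V hZF (upair a a)) as (x & Hx & K).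
  - intros E. apply (E a). apply in_upair. auto.
  - apply in_upair in Hx. assert (x = a) as -> by tauto.
    apply (K a H). apply in_upair. auto.
Qed.

Lemma ord_elem a x : ordinal a -> mem x a -> ordinal x.
Proof.
  intros [H1 H2] Hx. split; [apply H2; exact Hx|].
  intros y Hy. apply H2. exact (H1 x Hx y Hy).
Qed.

Lemma ord_trans a b c : ordinal c -> mem a b -> mem b c -> mem a c.
Proof. intros [H _] Ha Hb. exact (H b Hb a Ha). Qed.

(** A failure of the conclusion at [a] gives a nonempty set of failures in [a + 1],
    to which foundation applies. *)
Lemma ord_ind P : dfn (fun rho => P (rho 0)) ->
  (forall a, ordinal a -> (forall b, mem b a -> P b) -> P a) -> forall a, ordinal a -> P a.
Proof.
  intros HP H a Ha. apply NNPP. intros Na.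
  set (d := sep (succ a) (fun x => ~ P x)).
  assert (Hd : forall x, mem x d <-> mem x (succ a) /\ ~ P x) by (intros x; unfold d; rewrite in_sep by dfn_solve; tauto).
  destruct (@zf_foundation V hZF d) as (x & Hx & K).
  - intros E. apply (E a). apply Hd. rewrite in_succ. auto.
  - apply Hd in Hx. destruct Hx as [Hx Nx]. apply Nx. rewrite in_succ in Hx.
    assert (ox : ordinal x) by (destruct Hx as [Hx| ->]; [exact (ord_elem Ha Hx) | exact Ha]).
    apply H; [exact ox|]. intros y Hy. apply NNPP. intros Ny.
    apply (K y Hy). apply Hd. split; [|exact Ny]. apply in_succ. left.
    destruct Hx as [Hx| ->]; [exact (ord_trans Ha Hy Hx) | exact Hy].
Qed.

Lemma ord_trichotomy a b : ordinal a -> ordinal b -> mem a b \/ a = b \/ mem b a.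
Proof.
  intros Ha. revert b. revert a Ha.
  refine (@ord_ind (fun a => forall b, ordinal b -> mem a b \/ a = b \/ mem b a) _ _); [dfn_solve|cbv beta].
  intros a Ha IHa. refine (@ord_ind (fun b => mem a b \/ a = b \/ mem b a) _ _); [dfn_solve|cbv beta].
  intros b Hb IHb. apply NNPP. intros N.
  assert (a = b); [|tauto].
  apply extensionality. intros x. split; intros Hx.
  - destruct (IHa x Hx b Hb) as [K|[->|K]]; [exact K|tauto|].
    destruct N. right; right. exact (ord_trans Ha K Hx).
  - destruct (IHb x Hx) as [K|[->|K]]; [|tauto|exact K].
    destruct N. left. exact (ord_trans Hb K Hx).
Qed.

Lemma ole_refl a : ole a a.
Proof. right; reflexivity. Qed.

Lemma ole_or_lt a b : ordinal a -> ordinal b -> ole a b \/ mem b a.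
Proof. intros Ha Hb. destruct (ord_trichotomy Ha Hb) as [H|[H|H]]; unfold ole; auto. Qed.

Lemma ole_lt_trans a b c : ordinal c -> ole a b -> mem b c -> mem a c.
Proof. intros Hc [H| ->] K; [exact (ord_trans Hc H K) | exact K]. Qed.

Lemma lt_ole_trans a b c : ordinal c -> mem a b -> ole b c -> mem a c.
Proof. intros Hc H [K| <-]; [exact (ord_trans Hc H K) | exact H]. Qed.

Lemma ole_trans a b c : ordinal c -> ole a b -> ole b c -> ole a c.
Proof. intros Hc [H| ->] K; [left; exact (lt_ole_trans Hc H K) | exact K]. Qed.

Lemma ole_not_lt a b : ordinal b -> ole a b -> ~ mem b a.
Proof. intros Hb [H| ->] K; [|exact (mem_irrefl K)]. exact (mem_irrefl (ord_trans Hb K H)). Qed.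

Lemma ole_antisym a b : ordinal b -> ole a b -> ole b a -> a = b.
Proof. intros Hb H [K|K]; [destruct (ole_not_lt Hb H K) | auto]. Qed.

Lemma subset_ole a b : ordinal a -> ordinal b -> subset a b -> ole a b.
Proof.
  intros Ha Hb H. destruct (ole_or_lt Ha Hb) as [K|K]; [exact K|]. destruct (mem_irrefl (H b K)).
Qed.

Lemma ord_succ a : ordinal a -> ordinal (succ a).
Proof.
  intros Ha. split.
  - intros x Hx y Hy. apply in_succ. left. apply in_succ in Hx.
    destruct Hx as [Hx| ->]; [exact (ord_trans Ha Hy Hx) | exact Hy].
  - intros x Hx. apply in_succ in Hx.
    destruct Hx as [Hx| ->]; [exact (proj1 (ord_elem Ha Hx)) | exact (proj1 Ha)].
Qed.

Lemma lt_succ_ole a b : mem a (succ b) <-> ole a b.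
Proof. apply in_succ. Qed.

Lemma succ_ole a b : ordinal a -> ordinal b -> mem a b -> ole (succ a) b.
Proof.
  intros Ha Hb H. apply subset_ole; [apply ord_succ, Ha|exact Hb|].
  intros x Hx. apply in_succ in Hx. exact (ole_lt_trans Hb Hx H).
Qed.

Lemma ord_union a : (forall x, mem x a -> ordinal x) -> ordinal (union a).
Proof.
  intros H. split.
  - intros x Hx y Hy. apply in_union in Hx. destruct Hx as (z & Hz & Hx).
    apply in_union. exists z. split; [exact Hz|]. exact (ord_trans (H z Hz) Hy Hx).
  - intros x Hx. apply in_union in Hx. destruct Hx as (z & Hz & Hx). exact (proj2 (H z Hz) x Hx).
Qed.

Lemma ord_transitive_set a : transitive a -> (forall x, mem x a -> ordinal x) -> ordinal a.
Proof. intros H K. split; [exact H|]. intros x Hx. exact (proj1 (K x Hx)). Qed.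

Lemma least_exists P a : dfn (fun rho => P (rho 0)) -> ordinal a -> P a ->
  exists b, least P b /\ ole b a.
Proof.
  intros HP Ha. revert a Ha.
  refine (@ord_ind (fun a => P a -> exists b, least P b /\ ole b a) _ _); [dfn_solve|cbv beta].
  intros a Ha IH Pa. destruct (classic (exists b, mem b a /\ P b)) as [(b & Hb & Pb)|N].
  - destruct (IH b Hb Pb) as (c & Hc & Hcb). exists c. split; [exact Hc|]. left.
    exact (ole_lt_trans Ha Hcb Hb).
  - exists a. split; [|apply ole_refl]. split; [exact Ha|]. split; [exact Pa|]. eauto.
Qed.

Lemma least_unique P a b : least P a -> least P b -> a = b.
Proof.
  intros (Ha & Pa & La) (Hb & Pb & Lb).
  destruct (ord_trichotomy Ha Hb) as [H|[H|H]]; [destruct (Lb a H Pa)|exact H|destruct (La b H Pb)].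
Qed.

Lemma least_ole P a b : least P a -> ordinal b -> P b -> ole a b.
Proof.
  intros (Ha & Pa & La) Hb Pb. destruct (ole_or_lt Ha Hb) as [H|H]; [exact H|destruct (La b H Pb)].
Qed.

Lemma ord_max a b : ordinal a -> ordinal b -> exists c, (c = a \/ c = b) /\ ole a c /\ ole b c.
Proof.
  intros Ha Hb. destruct (ole_or_lt Ha Hb) as [H|H].
  - exists b. auto using ole_refl.
  - exists a. split; [auto|]. split; [apply ole_refl|left; exact H].
Qed.

Lemma ord_empty : ordinal empty.
Proof. split; intros x Hx; destruct (empty_spec Hx). Qed.

Lemma limit_succ (a x : V) : limit_ordinal a -> mem x a -> mem (succ x) a.
Proof.
  intros (oa & _ & L) Hx. destruct (succ_ole (ord_elem oa Hx) oa Hx) as [H|H]; [exact H|].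
  destruct (L x). apply is_succ_eq. auto.
Qed.

(** The strict supremum of a set of ordinals. *)
Definition ssup a : V := union (repl a succ).

Lemma in_ssup a x : mem x (ssup a) <-> exists y, mem y a /\ ole x y.
Proof.
  unfold ssup. rewrite in_union. setoid_rewrite in_repl; [|dfn_solve]. split.
  - intros (y & (z & Hz & ->) & Hx). exists z. rewrite <- lt_succ_ole. auto.
  - intros (y & Hy & Hx). exists (succ y). rewrite lt_succ_ole. eauto.
Qed.

Lemma ord_ssup a : (forall x, mem x a -> ordinal x) -> ordinal (ssup a).
Proof.
  intros H. apply ord_union. intros x Hx. apply in_repl in Hx; [|dfn_solve].
  destruct Hx as (y & Hy & ->). apply ord_succ, H, Hy.
Qed.

Lemma ssup_ole a b : (forall x, mem x a -> ordinal x) -> ordinal b ->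
  (forall x, mem x a -> mem x b) -> ole (ssup a) b.
Proof.
  intros H Hb K. apply subset_ole; [apply ord_ssup, H|exact Hb|].
  intros x Hx. apply in_ssup in Hx. destruct Hx as (y & Hy & Hx). exact (ole_lt_trans Hb Hx (K y Hy)).
Qed.

End Ordinals.

(** * Rank functions of well-founded relations *)

Section WellFounded.
Context {V : set_structure} {hZF : ZF V}.

Definition well_founded_on (X : V) (L : V -> V -> Prop) : Prop :=
  forall W, subset W X -> ~ is_empty W -> exists x, mem x W /\ forall y, mem y W -> ~ L y x.

Lemma in_ssup_repl (A : V) (F : V -> V) x : dterm (fun rho => F (rho 0)) ->
  (mem x (ssup (repl A F)) <-> exists y, mem y A /\ ole x (F y)).
Proof.
  intros HF. rewrite in_ssup. setoid_rewrite in_repl; [|exact HF]. split.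
  - intros (y & (z & Hz & ->) & H). eauto.
  - intros (y & Hy & H). eauto.
Qed.

Section Rank.
Context (X : V) (L : V -> V -> Prop) (HL : dfn (fun rho => L (rho 0) (rho 1))).
Context (Hwf : well_founded_on X L).

Lemma well_founded_induction_on (P : V -> Prop) : dfn (fun rho => P (rho 0)) ->
  (forall x, mem x X -> (forall y, mem y X -> L y x -> P y) -> P x) ->
  forall x, mem x X -> P x.
Proof.
  intros HP H x Hx. apply NNPP. intros Nx.
  set (W := sep X (fun x => ~ P x)).
  assert (HW : forall x, mem x W <-> mem x X /\ ~ P x)
    by (intros y; unfold W; rewrite in_sep by dfn_solve; tauto).
  destruct (@Hwf W) as (y & Hy & K).
  - intros y Hy. apply HW in Hy. tauto.
  - intros E. apply (E x). apply HW. auto.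
  - apply HW in Hy. destruct Hy as [Hy Ny]. apply Ny, H; [exact Hy|].
    intros z Hz Hzy. apply NNPP. intros Nz. apply (K z); [apply HW; auto|exact Hzy].
Qed.

Definition rank_step (r x : V) : V := ssup (repl (sep X (fun y => L y x)) (fun y => app r y)).

(** The domain [Z] may be a proper part of [X], closed under predecessors: such
    partial solutions of the recursion are the approximations from which the rank
    function on [X] is assembled. *)
Definition rank_function (Z r : V) : Prop :=
  subset Z X /\ (forall x y, mem x Z -> mem y X -> L y x -> mem y Z) /\
  is_fun r Z /\ forall x, mem x Z -> app r x = rank_step r x.

Lemma in_rank_step r x a :
  mem a (rank_step r x) <-> exists y, (mem y X /\ L y x) /\ ole a (app r y).
Proof.
  unfold rank_step. rewrite in_ssup_repl by dfn_solve.
  setoid_rewrite in_sep; [|dfn_solve]. reflexivity.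
Qed.

Lemma rank_step_ext r r' x : (forall y, mem y X -> L y x -> app r y = app r' y) ->
  rank_step r x = rank_step r' x.
Proof.
  intros H. apply extensionality. intros a. rewrite !in_rank_step.
  split; intros (y & [Hy Hyx] & Ha); exists y.
  - rewrite <- H; auto.
  - rewrite H; auto.
Qed.

Lemma rank_function_unique Z r Z' r' : rank_function Z r -> rank_function Z' r' ->
  forall x, mem x X -> mem x Z -> mem x Z' -> app r x = app r' x.
Proof.
  intros (_ & H1 & _ & H2) (_ & H1' & _ & H2').
  refine (@well_founded_induction_on
    (fun x => mem x Z -> mem x Z' -> app r x = app r' x) _ _); [dfn_solve|cbv beta].
  intros x Hx IH K K'. rewrite H2, H2' by assumption. apply rank_step_ext. eauto.
Qed.

Lemma rank_function_ord Z r : rank_function Z r -> forall x, mem x X -> mem x Z -> ordinal (app r x).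
Proof.
  intros (_ & H1 & _ & H2).
  refine (@well_founded_induction_on (fun x => mem x Z -> ordinal (app r x)) _ _);
    [dfn_solve|cbv beta].
  intros x Hx IH K. rewrite H2 by exact K. unfold rank_step. apply ord_ssup.
  intros a Ha. apply in_repl in Ha; [|dfn_solve]. destruct Ha as (y & Hy & ->).
  apply in_sep in Hy; [|dfn_solve]. destruct Hy. eauto.
Qed.

(** The partial rank functions agree, so their common extension to the set [G] of
    points where some of them is defined is again one; a minimal point outside [G]
    could be added to it. *)
Lemma rank_function_exists : exists r, rank_function X r.
Proof.
  set (val_at := fun x a => exists Z r, rank_function Z r /\ mem x Z /\ a = app r x).
  assert (Dr : dfn (fun rho => rank_function (rho 0) (rho 1))).
  { unfold rank_function, rank_step, ssup. dfn_solve. }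
  assert (Dv : dfn (fun rho => val_at (rho 0) (rho 1))) by (unfold val_at; dfn_solve).
  assert (Uv : forall x a b, mem x X -> val_at x a -> val_at x b -> b = a).
  { intros x a b Hx (Z & r & Hr & HZ & ->) (Z' & r' & Hr' & HZ' & ->).
    exact (rank_function_unique Hr' Hr Hx HZ' HZ). }
  set (rk x := the (val_at x)).
  assert (Dk : dterm (fun rho => rk (rho 0))) by (unfold rk; dfn_solve).
  assert (Ek : forall Z r x, rank_function Z r -> mem x Z -> rk x = app r x).
  { intros Z r x Hr HZ. pose proof (proj1 Hr x HZ) as Hx.
    assert (K : val_at x (app r x)) by (exists Z, r; auto).
    apply the_unique; [exact K|]. intros z Hz. exact (Uv _ _ _ Hx K Hz). }
  set (step x := ssup (repl (sep X (fun y => L y x)) rk)).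
  assert (Ds : dterm (fun rho => step (rho 0))) by (unfold step, ssup; dfn_solve).
  assert (Es : forall Z r x, rank_function Z r -> mem x Z -> rk x = step x).
  { intros Z r x Hr HZ. rewrite (Ek _ _ _ Hr HZ).
    destruct Hr as (H0 & H1 & H2 & H3). rewrite H3 by exact HZ.
    apply extensionality. intros a. rewrite in_rank_step. unfold step.
    rewrite in_ssup_repl by exact Dk. setoid_rewrite in_sep; [|dfn_solve].
    assert (Hr : rank_function Z r) by (repeat split; auto; apply H2).
    split; intros (y & [Hy Hyx] & Ha); exists y; (split; [auto|]);
      (rewrite (Ek Z r) || rewrite <- (Ek Z r)); eauto. }
  assert (All : forall x, mem x X -> exists Z r, rank_function Z r /\ mem x Z).
  { refine (@well_founded_induction_on (fun x => exists Z r, rank_function Z r /\ mem x Z) _ _);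
      [dfn_solve|cbv beta].
    intros x Hx IH.
    set (G := sep X (fun y => (exists Z r, rank_function Z r /\ mem y Z) \/ y = x)).
    assert (HG : forall y, mem y G <-> mem y X /\ ((exists Z r, rank_function Z r /\ mem y Z) \/ y = x))
      by (intros y; unfold G; rewrite in_sep by dfn_solve; tauto).
    set (F y := the (fun a => (exists Z r, rank_function Z r /\ mem y Z) /\ a = rk y \/
                  ~ (exists Z r, rank_function Z r /\ mem y Z) /\ a = step y)).
    assert (DF : dterm (fun rho => F (rho 0))) by (unfold F; dfn_solve).
    assert (EF : forall y, (exists Z r, rank_function Z r /\ mem y Z) -> F y = rk y).
    { intros y Hy. apply the_unique; [auto|]. intros z. tauto. }
    assert (EF' : forall y, mem y G -> F y = step y).
    { intros y Hy. destruct (classic (exists Z r, rank_function Z r /\ mem y Z)) as [K|K].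
      - rewrite EF by exact K. destruct K as (Z & r & Hr & HZ). exact (Es _ _ _ Hr HZ).
      - apply the_unique; [auto|]. intros z. tauto. }
    assert (Gc : forall y z, mem y G -> mem z X -> L z y -> exists Z r, rank_function Z r /\ mem z Z).
    { intros y z Hy Hz Hzy. apply HG in Hy. destruct Hy as [Hy [(Z & r & Hr & HZ)| ->]]; [|auto].
      exists Z, r. split; [exact Hr|]. exact (proj1 (proj2 Hr) y z HZ Hz Hzy). }
    exists G, (lam G F). split; [|apply HG; auto].
    split; [intros y Hy; apply HG in Hy; tauto|].
    split; [intros y z Hy Hz Hzy; apply HG; eauto|].
    split; [apply lam_fun; exact DF|].
    intros y Hy. rewrite app_lam by assumption. rewrite EF' by exact Hy.
    apply extensionality. intros a. rewrite in_rank_step. unfold step.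
    rewrite in_ssup_repl by exact Dk. setoid_rewrite in_sep; [|dfn_solve].
    split; intros (z & [Hz Hzy] & Ha); exists z; (split; [auto|]).
    - rewrite app_lam, EF; eauto. apply HG; eauto.
    - rewrite app_lam, EF in Ha; eauto. apply HG; eauto. }
  exists (lam X rk). split; [intros x Hx; exact Hx|]. split; [auto|].
  split; [apply lam_fun; exact Dk|].
  intros x Hx. rewrite app_lam by assumption.
  destruct (All x Hx) as (Z & r & Hr & HZ). rewrite (Es _ _ _ Hr HZ).
  apply extensionality. intros a. rewrite in_rank_step. unfold step.
  rewrite in_ssup_repl by exact Dk. setoid_rewrite in_sep; [|dfn_solve].
  split; intros (z & [Hz Hzy] & Ha); exists z; (split; [auto|]).
  - rewrite app_lam; auto.
  - rewrite app_lam in Ha; auto.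
Qed.

Lemma rank_function_le r x a : rank_function X r -> mem x X -> ordinal a ->
  (ole (app r x) a <-> forall y, mem y X -> L y x -> mem (app r y) a).
Proof.
  intros Hr Hx Ha. assert (Ho := fun x Hx => rank_function_ord Hr (x := x) Hx Hx).
  rewrite (proj2 (proj2 (proj2 Hr)) x Hx). split.
  - intros H y Hy Hyx. refine (lt_ole_trans Ha _ H). apply in_rank_step.
    exists y. split; [auto|apply ole_refl].
  - intros H. apply ssup_ole; [|exact Ha|]; intros b Hb;
      (apply in_repl in Hb; [|dfn_solve]); destruct Hb as (y & Hy & ->);
      (apply in_sep in Hy; [|dfn_solve]); destruct Hy; auto.
Qed.

Lemma rank_function_lt r x y : rank_function X r -> mem x X -> mem y X -> L y x ->
  mem (app r y) (app r x).
Proof.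
  intros Hr Hx Hy H. assert (Ho := rank_function_ord Hr Hx Hx).
  exact (proj1 (rank_function_le Hr Hx Ho) (ole_refl _) y Hy H).
Qed.

(** The values of a rank function form an ordinal: any ordinal below a value is the
    rank of some point further down. *)
Lemma rank_function_surj r a : rank_function X r -> ordinal a ->
  (exists x, mem x X /\ ole a (app r x)) -> exists x, mem x X /\ a = app r x.
Proof.
  intros Hr Ha. assert (Ho := fun x Hx => rank_function_ord Hr (x := x) Hx Hx).
  intros (x0 & Hx0 & H0).
  revert x0 Hx0 H0. refine (@well_founded_induction_on
    (fun x => ole a (app r x) -> exists x, mem x X /\ a = app r x) _ _); [dfn_solve|cbv beta].
  intros x Hx IH [H|H]; [|eauto].
  rewrite (proj2 (proj2 (proj2 Hr)) x Hx) in H. apply in_rank_step in H.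
  destruct H as (y & [Hy Hyx] & H). eauto.
Qed.

End Rank.
End WellFounded.

(** * Sizes of images of ordinals *)

Section Collapse.
Context {V : set_structure} {hZF : ZF V}.

Lemma bijection_lam (A B : V) (F : V -> V) : dterm (fun rho => F (rho 0)) ->
  (forall x, mem x A -> mem (F x) B) ->
  (forall x y, mem x A -> mem y A -> F x = F y -> x = y) ->
  (forall y, mem y B -> exists x, mem x A /\ y = F x) -> equinumerous A B.
Proof.
  intros HF H1 H2 H3. exists (lam A F). split; [split; [split|]|].
  - apply lam_fun, HF.
  - intros x y H. apply val_lam in H; [|exact HF]. destruct H as [H ->]. auto.
  - intros y Hy. destruct (H3 y Hy) as (x & Hx & ->). exists x. apply val_lam; auto.
  - intros x x' y Hx Hx'. apply val_lam in Hx, Hx'; try exact HF. destruct Hx, Hx'.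
    apply H2; congruence.
Qed.

(** Send an element of the image to its least preimage; the rank function of the
    membership relation collapses the resulting set of ordinals onto an ordinal. *)
Lemma image_of_ordinal (s : V) (F : V -> V) : ordinal s -> dterm (fun rho => F (rho 0)) ->
  exists b, ole b s /\ equinumerous (repl s F) b.
Proof.
  intros Hs HF.
  set (M := sep s (fun x => forall y, mem y x -> F y <> F x)).
  assert (HM : forall x, mem x M <-> mem x s /\ forall y, mem y x -> F y <> F x)
    by (intros x; unfold M; rewrite in_sep by dfn_solve; tauto).
  assert (oM : forall x, mem x M -> ordinal x) by (intros x Hx; apply HM in Hx; exact (ord_elem Hs (proj1 Hx))).
  assert (Dm : dfn (fun rho : nat -> V => mem (rho 0) (rho 1))) by dfn_solve.
  assert (wM : well_founded_on M (fun y x => mem y x)).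
  { intros W HW NW. destruct (@zf_foundation V hZF W NW) as (x & Hx & K).
    exists x. split; [exact Hx|]. intros y Hy Hyx. exact (K y Hyx Hy). }
  destruct (rank_function_exists Dm wM) as [r Hr].
  assert (Ho : forall x, mem x M -> ordinal (app r x)) by (intros x Hx; exact (rank_function_ord Dm wM Hr Hx Hx)).
  assert (Hle : forall x, mem x M -> ole (app r x) x).
  { intros x Hx. pose proof (oM x Hx) as ox. revert x ox Hx.
    refine (@ord_ind _ _ (fun x => mem x M -> ole (app r x) x) _ _); [dfn_solve|cbv beta].
    intros x ox IH Hx. apply (rank_function_le Dm wM Hr Hx ox).
    intros y Hy Hyx. exact (ole_lt_trans ox (IH y Hyx Hy) Hyx). }
  set (b := repl M (fun x => app r x)).
  assert (Hb : forall a, mem a b <-> exists x, mem x M /\ a = app r x)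
    by (intros a; unfold b; rewrite in_repl by dfn_solve; tauto).
  assert (ob : ordinal b).
  { apply ord_transitive_set.
    - intros a Ha c Hc. apply Hb in Ha. destruct Ha as (x & Hx & ->). apply Hb.
      apply (rank_function_surj Dm wM Hr (ord_elem (Ho x Hx) Hc)). exists x. split; [exact Hx|left; exact Hc].
    - intros a Ha. apply Hb in Ha. destruct Ha as (x & Hx & ->). auto. }
  exists b. split.
  - apply subset_ole; [exact ob|exact Hs|]. intros a Ha. apply Hb in Ha. destruct Ha as (x & Hx & ->).
    apply (ole_lt_trans Hs (Hle x Hx)). apply HM in Hx. tauto.
  - set (pre z := the (fun x => mem x M /\ F x = z)).
    assert (Inj : forall x y, mem x M -> mem y M -> F x = F y -> x = y).
    { intros x y Hx Hy E. destruct (ord_trichotomy (oM x Hx) (oM y Hy)) as [K|[K|K]]; [|exact K|].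
      - apply HM in Hy. destruct (proj2 Hy x K E).
      - apply HM in Hx. destruct (proj2 Hx y K). auto. }
    assert (Pre : forall x, mem x M -> pre (F x) = x).
    { intros x Hx. apply the_unique; [auto|]. intros z [Hz E]. auto. }
    assert (Im : forall z, mem z (repl s F) -> exists x, mem x M /\ z = F x).
    { intros z Hz. apply in_repl in Hz; [|exact HF]. destruct Hz as (x & Hx & ->).
      destruct (@least_exists _ _ (fun y => mem y s /\ F y = F x) x) as (y & (Hy & [K1 K2] & K3) & _);
        [dfn_solve|exact (ord_elem Hs Hx)|auto|].
      exists y. split; [|auto]. apply HM. split; [exact K1|]. intros w Hw E.
      apply (K3 w Hw). split; [exact (ord_trans Hs Hw K1)|congruence]. }
    apply (@bijection_lam (repl s F) b (fun z => app r (pre z))).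
    + unfold pre. dfn_solve.
    + intros z Hz. destruct (Im z Hz) as (x & Hx & ->). rewrite Pre by exact Hx. apply Hb. eauto.
    + intros z w Hz Hw. destruct (Im z Hz) as (x & Hx & ->), (Im w Hw) as (y & Hy & ->).
      rewrite !Pre by assumption. intros E.
      destruct (ord_trichotomy (oM x Hx) (oM y Hy)) as [K|[K|K]]; [|congruence|];
        (apply (rank_function_lt Dm wM Hr) in K; [|assumption|assumption]);
        rewrite E in K; destruct (mem_irrefl K).
    + intros a Ha. apply Hb in Ha. destruct Ha as (x & Hx & ->). exists (F x).
      split; [|rewrite Pre by exact Hx; reflexivity].
      apply in_repl; [exact HF|]. exists x. split; [|reflexivity]. apply HM in Hx. tauto.
Qed.

(** The image of a smaller ordinal is equinumerous with a smaller ordinal. *)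
Lemma no_onto_larger_cardinal (s l f : V) : ordinal s -> cardinal l -> mem s l -> ~ onto f s l.
Proof.
  intros Hs [Hl Cl] Hsl [[Hf1 Hf2] Hf3].
  destruct (@image_of_ordinal s (fun x => app f x) Hs) as (b & Hb & E); [dfn_solve|].
  replace (repl s (fun x => app f x)) with l in E.
  - apply (Cl b); [exact (ole_lt_trans Hl Hb Hsl)|].
    destruct E as (g & [[[G1 G2] G3] G4]).
    apply (@bijection_lam b l (fun y => the (fun x => val g x y))).
    + dfn_solve.
    + intros y Hy. destruct (G3 y Hy) as (x & Hx).
      rewrite (@the_unique _ _ _ x); [exact (val_dom G1 Hx)|exact Hx|]. eauto.
    + intros y z Hy Hz. destruct (G3 y Hy) as (x & Hx), (G3 z Hz) as (w & Hw).
      rewrite (@the_unique _ _ _ x), (@the_unique _ _ _ w); eauto.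
      intros ->. exact (val_functional G1 Hx Hw).
    + intros x Hx. exists (app g x). pose proof (app_val G1 Hx) as K. split; [eauto|].
      symmetry. apply the_unique; eauto.
  - apply extensionality. intros y. rewrite in_repl by dfn_solve. split.
    + intros Hy. destruct (Hf3 y Hy) as (x & Hx). apply (val_app _ _ Hf1) in Hx. destruct Hx; eauto.
    + intros (x & Hx & ->). exact (Hf2 _ _ (app_val Hf1 Hx)).
Qed.

End Collapse.

(** * Functions into the ordinals modulo a filter *)

Section OrdinalFunctions.
Context {V : set_structure} {hZF : ZF V}.

Definition product (A B : V) : V := union (repl A (fun a => repl B (fun b => opair a b))).

Lemma in_product A B p : mem p (product A B) <-> exists a b, mem a A /\ mem b B /\ p = opair a b.
Proof.
  unfold product. rewrite in_union. setoid_rewrite in_repl; [|dfn_solve]. split.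
  - intros (y & (a & Ha & ->) & H). apply in_repl in H; [|dfn_solve].
    destruct H as (b & Hb & ->). eauto 6.
  - intros (a & b & Ha & Hb & ->). eexists. split; [eauto|]. apply in_repl; [dfn_solve|eauto].
Qed.

Definition funs (Y B : V) : V := sep (power (product Y B)) (fun f => maps f Y B).

Lemma maps_app (f A B : V) : maps f A B <-> is_fun f A /\ forall x, mem x A -> mem (app f x) B.
Proof.
  split; intros [H1 H2]; (split; [exact H1|]).
  - intros x Hx. exact (H2 _ _ (app_val H1 Hx)).
  - intros x y H. apply (val_app _ _ H1) in H. destruct H as [H ->]. auto.
Qed.

Lemma in_funs (Y B f : V) : mem f (funs Y B) <-> maps f Y B.
Proof.
  unfold funs. rewrite in_sep by dfn_solve. rewrite in_power. split; [tauto|].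
  intros H. split; [|exact H]. intros p Hp.
  destruct (proj1 (proj1 H) p Hp) as (x & y & Hx & E). apply is_opair_eq in E. subst p.
  apply in_product. exists x, y. repeat split; auto. apply (proj2 H x y). apply val_opair, Hp.
Qed.

Lemma ord_fun_app (f A : V) : ord_fun f A <-> is_fun f A /\ forall x, mem x A -> ordinal (app f x).
Proof.
  split; intros [H1 H2]; (split; [exact H1|]).
  - intros x Hx. exact (H2 _ _ (app_val H1 Hx)).
  - intros x y H. apply (val_app _ _ H1) in H. destruct H as [H ->]. auto.
Qed.

Lemma ord_fun_lam (A : V) (F : V -> V) : dterm (fun rho => F (rho 0)) ->
  (forall x, mem x A -> ordinal (F x)) -> ord_fun (lam A F) A.
Proof.
  intros HF H. apply ord_fun_app. split; [apply lam_fun, HF|].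
  intros x Hx. rewrite app_lam; auto.
Qed.

Lemma maps_ord_fun (f A B : V) : ordinal B -> maps f A B -> ord_fun f A.
Proof. intros HB [H1 H2]. split; [exact H1|]. intros x y H. exact (ord_elem HB (H2 x y H)). Qed.

Definition bound (Y f : V) : V := ssup (repl Y (fun s => app f s)).

Lemma ord_bound (Y f : V) : ord_fun f Y -> ordinal (bound Y f).
Proof.
  intros Hf. apply ord_fun_app in Hf. apply ord_ssup. intros a Ha.
  apply in_repl in Ha; [|dfn_solve]. destruct Ha as (s & Hs & ->). apply Hf, Hs.
Qed.

Lemma maps_bound (Y f g : V) : is_fun g Y -> (forall s, mem s Y -> ole (app g s) (app f s)) ->
  maps g Y (bound Y f).
Proof.
  intros Hg H. apply maps_app. split; [exact Hg|]. intros s Hs. unfold bound.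
  rewrite in_ssup_repl by dfn_solve. eauto.
Qed.

End OrdinalFunctions.

Section Filters.
Context {V : set_structure} {hZF : ZF V}.
Context (Y D : V) (hD : filter_on Y D).
Implicit Types (P Q C : V -> Prop) (f g h : V).
Notation most := (for_D_most Y D).

Lemma most_all P : (forall s, mem s Y -> P s) -> most P.
Proof. intros H. exists Y. split; [apply hD|]. intros s. split; [auto|tauto]. Qed.

Lemma most_congr P Q : (forall s, mem s Y -> (P s <-> Q s)) -> most P <-> most Q.
Proof.
  intros H. split; intros (A & HA & K); exists A; (split; [exact HA|]); intros s; rewrite K;
    split; intros [Hs Ps]; (split; [exact Hs|]); apply (H s Hs); exact Ps.
Qed.

Lemma most_and P Q : most P -> most Q -> most (fun s => P s /\ Q s).
Proof.
  intros (A & HA & K) (B & HB & L). destruct hD as (_ & _ & _ & _ & H).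
  destruct (H A B HA HB) as (I & HI & M). exists I. split; [exact HI|].
  intros s. rewrite M, K, L. tauto.
Qed.

Lemma most_sep P : dfn (fun rho => P (rho 0)) -> (most P <-> mem (sep Y P) D).
Proof.
  intros HP. split.
  - intros (A & HA & K). replace (sep Y P) with A; [exact HA|].
    apply extensionality. intros s. rewrite in_sep, K by exact HP. tauto.
  - intros H. exists (sep Y P). split; [exact H|]. intros s. apply in_sep, HP.
Qed.

Lemma most_impl P Q : dfn (fun rho => Q (rho 0)) -> most P ->
  (forall s, mem s Y -> P s -> Q s) -> most Q.
Proof.
  intros HQ (A & HA & K) H. apply most_sep; [exact HQ|].
  destruct hD as (_ & _ & _ & M & _). apply (M A); [exact HA| |].
  - intros s Hs. apply in_sep; [exact HQ|]. apply K in Hs. destruct Hs. auto.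
  - intros s Hs. apply in_sep in Hs; [tauto|exact HQ].
Qed.

Lemma most_impl2 P Q C : dfn (fun rho => C (rho 0)) -> most P -> most Q ->
  (forall s, mem s Y -> P s -> Q s -> C s) -> most C.
Proof.
  intros HC HP HQ H. apply (most_impl HC (most_and HP HQ)). intros s Hs []. auto.
Qed.

Lemma most_ex P : most P -> exists s, mem s Y /\ P s.
Proof.
  intros (A & HA & K). destruct (@is_empty_not _ A) as (s & Hs).
  - intros E. destruct hD as (_ & _ & H & _). exact (H A E HA).
  - exists s. apply K, Hs.
Qed.

Lemma most_ultra P : ultrafilter_on Y D -> dfn (fun rho => P (rho 0)) ->
  most P \/ most (fun s => ~ P s).
Proof.
  intros [_ U] HP. destruct (U (sep Y P)) as [H|(C & HC & H)].
  - intros s Hs. apply in_sep in Hs; [tauto|exact HP].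
  - left. apply most_sep; assumption.
  - right. exists C. split; [exact H|]. intros s. rewrite (HC s), in_sep by exact HP. tauto.
Qed.

(** The family of sets indexed by [s] is a set of members of [D] whose size is that
    of an ordinal at most [s], by [image_of_ordinal]; choice is not involved. *)
Lemma complete_most (k s : V) (P : V -> V -> Prop) : complete_filter Y D k -> ordinal k -> mem s k ->
  dfn (fun rho => P (rho 0) (rho 1)) ->
  (forall j, mem j s -> most (P j)) -> most (fun y => forall j, mem j s -> P j y).
Proof.
  intros HC Hk Hs HP H.
  destruct (@image_of_ordinal _ _ s (fun j => sep Y (P j))) as (b & Hb & E);
    [exact (ord_elem Hk Hs)|dfn_solve|].
  destruct (HC (repl s (fun j => sep Y (P j)))) as (I & HI & K).
  - intros A HA. apply in_repl in HA; [|dfn_solve]. destruct HA as (j & Hj & ->).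
    apply most_sep; [dfn_solve|auto].
  - exists b. split; [exact (ole_lt_trans Hk Hb Hs)|exact E].
  - exists I. split; [exact HI|]. intros y. rewrite K. split; intros [Hy M]; (split; [exact Hy|]).
    + intros j Hj. specialize (M (sep Y (P j))). rewrite in_sep in M by dfn_solve.
      apply M. apply in_repl; [dfn_solve|eauto].
    + intros A HA. apply in_repl in HA; [|dfn_solve]. destruct HA as (j & Hj & ->).
      apply in_sep; [dfn_solve|auto].
Qed.

(** ** The orders modulo the filter *)

Lemma lt_mod_app f g : is_fun f Y -> is_fun g Y ->
  (lt_mod Y D f g <-> most (fun s => mem (app f s) (app g s))).
Proof.
  intros Hf Hg. apply most_congr. intros s Hs. setoid_rewrite (val_app _ _ Hf).
  setoid_rewrite (val_app _ _ Hg). split.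
  - intros (a & b & [_ ->] & [_ ->] & H). exact H.
  - intros H. eauto 8.
Qed.

Lemma le_mod_app f g : is_fun f Y -> is_fun g Y ->
  (le_mod Y D f g <-> most (fun s => ole (app f s) (app g s))).
Proof.
  intros Hf Hg. apply most_congr. intros s Hs. setoid_rewrite (val_app _ _ Hf).
  setoid_rewrite (val_app _ _ Hg). split.
  - intros (a & b & [_ ->] & [_ ->] & H). exact H.
  - intros H. eauto 8.
Qed.

Lemma lt_le_mod_trans f g h : is_fun f Y -> is_fun g Y -> ord_fun h Y ->
  lt_mod Y D f g -> le_mod Y D g h -> lt_mod Y D f h.
Proof.
  intros Hf Hg Hh H K. apply ord_fun_app in Hh. destruct Hh as [Hh Oh].
  rewrite lt_mod_app, le_mod_app in * by assumption.
  refine (most_impl2 _ H K _); [dfn_solve|]. intros s Hs. apply lt_ole_trans. auto.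
Qed.

Lemma lt_le_mod f g : is_fun f Y -> is_fun g Y -> lt_mod Y D f g -> le_mod Y D f g.
Proof.
  intros Hf Hg. rewrite lt_mod_app, le_mod_app by assumption. intros H.
  refine (most_impl _ H _); [dfn_solve|]. intros s _ K. left. exact K.
Qed.

Lemma lt_mod_trans f g h : is_fun f Y -> is_fun g Y -> ord_fun h Y ->
  lt_mod Y D f g -> lt_mod Y D g h -> lt_mod Y D f h.
Proof.
  intros Hf Hg Hh H K. refine (lt_le_mod_trans Hf Hg Hh H (lt_le_mod Hg _ K)). apply Hh.
Qed.

Lemma le_mod_refl f : is_fun f Y -> le_mod Y D f f.
Proof. intros Hf. apply le_mod_app; [exact Hf|exact Hf|]. apply most_all. intros; apply ole_refl. Qed.

(** Functions below [f] modulo the filter form a proper class; up to equality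
    modulo the filter they are bounded by [f] everywhere, hence form a set. *)
Lemma clip f g : ord_fun f Y -> ord_fun g Y -> lt_mod Y D g f ->
  exists h, ord_fun h Y /\ (forall s, mem s Y -> ole (app h s) (app f s)) /\
    lt_mod Y D h f /\ le_mod Y D g h /\ le_mod Y D h g.
Proof.
  intros Hf Hg H. apply ord_fun_app in Hf, Hg. destruct Hf as [Hf Of], Hg as [Hg Og].
  rewrite lt_mod_app in H by assumption.
  set (F s := the (fun a => mem (app g s) (app f s) /\ a = app g s \/
                   ~ mem (app g s) (app f s) /\ a = app f s)).
  assert (DF : dterm (fun rho => F (rho 0))) by (unfold F; dfn_solve).
  assert (F1 : forall s, mem (app g s) (app f s) -> F s = app g s)
    by (intros s Hs; apply the_unique; [auto|intros; tauto]).
  assert (F2 : forall s, ~ mem (app g s) (app f s) -> F s = app f s)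
    by (intros s Hs; apply the_unique; [auto|intros; tauto]).
  exists (lam Y F). assert (Hl : is_fun (lam Y F) Y) by (apply lam_fun, DF).
  rewrite lt_mod_app, !le_mod_app by assumption.
  split; [|split; [|split; [|split]]].
  - apply ord_fun_lam; [exact DF|]. intros s Hs.
    destruct (classic (mem (app g s) (app f s))) as [K|K]; rewrite ?(F1 _ K), ?(F2 _ K); auto.
  - intros s Hs. rewrite app_lam by assumption.
    destruct (classic (mem (app g s) (app f s))) as [K|K]; rewrite ?(F1 _ K), ?(F2 _ K);
      [left; exact K|apply ole_refl].
  - refine (most_impl _ H _); [dfn_solve|]. intros s Hs K.
    rewrite app_lam, F1 by assumption. exact K.
  - refine (most_impl _ H _); [dfn_solve|]. intros s Hs K.
    rewrite app_lam, F1 by assumption. apply ole_refl.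
  - refine (most_impl _ H _); [dfn_solve|]. intros s Hs K.
    rewrite app_lam, F1 by assumption. apply ole_refl.
Qed.

End Filters.

(** * The rank of an ordinal function modulo a filter *)

Section RankTheory.
Context {V : set_structure} {hZF : ZF V}.
Context (Y D : V) (hD : filter_on Y D).
Context (R : V -> V -> Prop) (hR : is_rank Y D R).
Implicit Types (f g h a b : V).

Lemma rank_definable : definable2 R.
Proof. apply hR. Qed.

Lemma rank_fun f a : R f a -> ord_fun f Y.
Proof. intros H. apply hR in H. tauto. Qed.

Lemma rank_ord f a : R f a -> ordinal a.
Proof. intros H. apply hR in H. tauto. Qed.

Lemma rank_unique f a b : R f a -> R f b -> a = b.
Proof.
  intros Ha Hb. pose proof (proj1 (proj2 hR f a) Ha) as (_ & oa & Na & _).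
  pose proof (proj1 (proj2 hR f b) Hb) as (_ & ob & Nb & _).
  destruct (ord_trichotomy oa ob) as [K|[K|K]]; [|exact K|].
  - destruct (Nb a K Ha).
  - destruct (Na b K Hb).
Qed.

Lemma rank_below f g a : R f a -> ord_fun g Y -> lt_mod Y D g f -> exists b, mem b a /\ R g b.
Proof. intros Ha Hg H. apply hR in Ha. apply Ha; assumption. Qed.

Lemma rank_lt f g a b : R f a -> R g b -> lt_mod Y D g f -> mem b a.
Proof.
  intros Ha Hb H. destruct (rank_below Ha (rank_fun Hb) H) as (c & Hc & K).
  rewrite (rank_unique Hb K). exact Hc.
Qed.

(** The rank is the least ordinal above the ranks of all smaller functions. *)
Lemma rank_le f a b : R f a -> ordinal b ->
  (forall g, ord_fun g Y -> lt_mod Y D g f -> exists c, mem c b /\ R g c) -> ole a b.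
Proof.
  intros Ha ob H. pose proof rank_definable as dR.
  destruct (@least_exists _ _ (fun b => forall g, ord_fun g Y -> lt_mod Y D g f ->
     exists c, mem c b /\ R g c) b) as (m & Hm & Hmb); [dfn_solve|exact ob|exact H|].
  replace a with m; [exact Hmb|]. apply (@rank_unique f); [|exact Ha].
  apply hR. destruct Hm as (om & Pm & Lm).
  split; [exact (rank_fun Ha)|]. split; [exact om|]. split; [|exact Pm].
  intros c Hc K. apply (Lm c Hc). intros g Hg Hgf. exact (rank_below K Hg Hgf).
Qed.

Lemma rank_mono f g a b : R f a -> R g b -> le_mod Y D f g -> ole a b.
Proof.
  intros Ha Hb H. apply (rank_le Ha (rank_ord Hb)). intros h Hh K.
  apply (rank_below Hb Hh). 
  exact (lt_le_mod_trans hD (proj1 Hh) (proj1 (rank_fun Ha)) (rank_fun Hb) K H).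
Qed.

(** Some function below [f] has rank at least [b], since otherwise [f] would have
    rank at most [b].  One with the least such rank has only functions of rank less
    than [b] below it, so its rank is [b]. *)
Lemma rank_no_hole f a b : R f a -> mem b a -> exists g, ord_fun g Y /\ lt_mod Y D g f /\ R g b.
Proof.
  intros Ha Hb. pose proof rank_definable as dR. pose proof (rank_ord Ha) as oa.
  pose proof (ord_elem oa Hb) as ob.
  apply NNPP. intros N.
  set (Q := fun c => ole b c /\ exists g, ord_fun g Y /\ lt_mod Y D g f /\ R g c).
  assert (E : exists c, ordinal c /\ Q c).
  { apply NNPP. intros N'.
    refine (ole_not_lt ob (rank_le Ha ob _) Hb).
    intros g Hg H. destruct (rank_below Ha Hg H) as (c & Hc & K). exists c. split; [|exact K].
    pose proof (ord_elem oa Hc) as oc.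
    destruct (ole_or_lt ob oc) as [L|L]; [|exact L]. destruct N'. exists c. split; [exact oc|].
    split; [exact L|eauto]. }
  destruct E as (c & oc & Qc).
  destruct (@least_exists _ _ Q c) as (m & (om & (Hbm & g & Hg & Hgf & Rg) & Lm) & _);
    [unfold Q; dfn_solve|exact oc|exact Qc|].
  destruct Hbm as [Hbm| ->]; [|eauto].
  refine (ole_not_lt ob (rank_le Rg ob _) Hbm).
  intros h Hh H. destruct (rank_below Rg Hh H) as (e & He & K). exists e. split; [|exact K].
  pose proof (ord_elem om He) as oe.
  destruct (ole_or_lt ob oe) as [L|L]; [|exact L].
  destruct (Lm e He). split; [exact L|]. exists h. split; [exact Hh|]. split; [|exact K].
  exact (lt_mod_trans hD (proj1 Hh) (proj1 Hg) (rank_fun Ha) H Hgf).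
Qed.

Lemma eq_succ_mod_app f g : ord_fun f Y -> ord_fun g Y ->
  (eq_succ_mod Y D f g <-> for_D_most Y D (fun s => app f s = succ (app g s))).
Proof.
  intros [Hf _] [Hg _]. apply most_congr. intros s Hs. setoid_rewrite (val_app _ _ Hf).
  setoid_rewrite (val_app _ _ Hg). split.
  - intros (a & b & [_ ->] & [_ ->] & H). apply is_succ_eq, H.
  - intros H. do 2 eexists. repeat split; auto; rewrite H; apply in_succ.
Qed.

Lemma rank_succ f g a b : eq_succ_mod Y D f g -> R f a -> R g b -> a = succ b.
Proof.
  intros H Ha Hb. pose proof (rank_fun Ha) as Hf. pose proof (rank_fun Hb) as Hg.
  pose proof (rank_ord Ha) as oa. pose proof (rank_ord Hb) as ob.
  apply (eq_succ_mod_app Hf Hg) in H.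
  apply ole_antisym; [apply ord_succ, ob| |].
  - apply (rank_le Ha (ord_succ ob)). intros h Hh K.
    destruct (rank_below Ha Hh K) as (c & Hc & Rc). exists c. split; [|exact Rc].
    apply lt_succ_ole. apply (rank_mono Rc Hb).
    rewrite lt_mod_app in K by (apply Hh || apply Hf). apply le_mod_app; [apply Hh|apply Hg|].
    refine (most_impl2 hD _ H K _); [dfn_solve|]. intros s Hs -> L. apply lt_succ_ole, L.
  - apply succ_ole; [exact ob|exact oa|]. apply (rank_lt Ha Hb).
    apply lt_mod_app; [apply Hg|apply Hf|].
    refine (most_impl hD _ H _); [dfn_solve|]. intros s Hs ->. apply lt_succ_ole, ole_refl.
Qed.

End RankTheory.

Section RankUnique.
Context {V : set_structure} {hZF : ZF V}.

(** The recursion clause at [a] mentions only ranks below [a], so induction on [a]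
    shows that it has one definable solution. *)
Lemma is_rank_unique (Y D : V) (R R' : V -> V -> Prop) : is_rank Y D R -> is_rank Y D R' ->
  forall f a, R f a <-> R' f a.
Proof.
  intros hR hR' f a. pose proof (proj1 hR) as dR. pose proof (proj1 hR') as dR'.
  assert (K : forall a, ordinal a -> forall f, R f a <-> R' f a).
  { clear f a. refine (@ord_ind _ _ (fun a => forall f, R f a <-> R' f a) _ _); [dfn_solve|cbv beta].
    intros a oa IH f. rewrite (proj2 hR f a), (proj2 hR' f a).
    split; intros (H1 & H2 & H3 & H4);
      (split; [exact H1|]; split; [exact H2|]; split).
    - intros b Hb. rewrite <- IH; auto.
    - intros g Hg H. destruct (H4 g Hg H) as (b & Hb & Rb). exists b. rewrite <- IH; auto.
    - intros b Hb. rewrite IH; auto.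
    - intros g Hg H. destruct (H4 g Hg H) as (b & Hb & Rb). exists b. rewrite IH; auto. }
  split; intros H.
  - exact (proj1 (K a (rank_ord hR H) f) H).
  - exact (proj2 (K a (rank_ord hR' H) f) H).
Qed.

End RankUnique.

(** ** Existence of ranks *)

Section RankExistence.
Context {V : set_structure} {hZF : ZF V}.

Definition functions_below (Y D B : V) (r : V) : Prop :=
  rank_function (funs Y B) (lt_mod Y D) (funs Y B) r.

(** The bound [B] is not determined by [f]: any choice gives the same value, by
    [canonical_rank_mono]. *)
Definition canonical_rank (Y D f a : V) : Prop :=
  exists B r, ordinal B /\ mem f (funs Y B) /\ functions_below Y D B r /\ a = app r f.

Definition well_founded_mod (Y D : V) : Prop :=
  forall B, ordinal B -> well_founded_on (funs Y B) (lt_mod Y D).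

(** Dependent choice turns a set without minimal element into a decreasing
    sequence modulo [D], and countable completeness finds a point at which its
    values decrease strictly. *)
Lemma complete_well_founded (Y D k w : V) : DC V -> filter_on Y D -> complete_filter Y D k ->
  ordinal k -> is_omega w -> mem w k -> well_founded_mod Y D.
Proof.
  intros hDC hD hC ok Hw Hwk B oB W HW NW. apply NNPP. intros N.
  pose proof (ord_elem ok Hwk) as ow. pose proof (proj1 (proj2 Hw)) as Lw.
  set (S := sep (product W W) (fun p => exists x y, p = opair x y /\ lt_mod Y D y x)).
  assert (HS : forall x y, val S x y <-> (mem x W /\ mem y W) /\ lt_mod Y D y x).
  { intros x y. rewrite val_opair. unfold S. rewrite in_sep by dfn_solve. rewrite in_product. split.
    - intros [(a & b & Ha & Hb & E) (c & d & E' & H)].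
      apply opair_inj in E, E'. destruct E as [-> ->], E' as [-> ->]. auto.
    - intros [[Hx Hy] H]. split; eauto 8. }
  destruct (hDC W S NW) with (w := w) as (F & HF & HFS); [|exact Hw|].
  { intros x Hx. apply NNPP. intros K. apply N. exists x. split; [exact Hx|].
    intros y Hy L. apply K. exists y. split; [exact Hy|]. apply HS. auto. }
  apply maps_app in HF. destruct HF as [HF HFW].
  assert (Hfun : forall n, mem n w -> ord_fun (app F n) Y).
  { intros n Hn. apply (maps_ord_fun oB), in_funs. apply HW. auto. }
  assert (Hstep : forall n, mem n w ->
            for_D_most Y D (fun s => mem (app (app F (succ n)) s) (app (app F n) s))).
  { intros n Hn. assert (Hn' := limit_succ Lw Hn).
    apply lt_mod_app; [apply Hfun, Hn'|apply Hfun, Hn|].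
    refine (proj2 (proj1 (HS _ _) (HFS n (succ n) (app F n) (app F (succ n)) _ _ _)));
      [apply is_succ_eq; reflexivity|apply (app_val HF)|apply (app_val HF)]; assumption. }
  apply (@complete_most _ _ Y D k w (fun n s => mem (app (app F (succ n)) s) (app (app F n) s)))
    in Hstep; [|exact hC|exact ok|exact Hwk|dfn_solve].
  destruct (most_ex hD Hstep) as (s & Hs & H). 
  destruct (@zf_foundation V hZF (repl w (fun n => app (app F n) s))) as (m & Hm & K).
  - destruct (is_empty_not (proj1 (proj2 Lw))) as (n & Hn). intros E.
    apply (E (app (app F n) s)). apply in_repl; [dfn_solve|eauto].
  - apply in_repl in Hm; [|dfn_solve]. destruct Hm as (n & Hn & ->).
    apply (K _ (H n Hn)). apply in_repl; [dfn_solve|]. exists (succ n).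
    split; [exact (limit_succ Lw Hn)|reflexivity].
Qed.

Context (Y D : V) (hD : filter_on Y D) (hwf : well_founded_mod Y D).

Lemma dfn_lt_mod : dfn (fun rho => lt_mod Y D (rho 0) (rho 1)).
Proof. dfn_solve. Qed.

Lemma canonical_rank_definable : dfn (fun rho => canonical_rank Y D (rho 0) (rho 1)).
Proof.
  unfold canonical_rank, functions_below, rank_function, rank_step, funs, product, ssup. dfn_solve.
Qed.

Lemma canonical_rank_total f : ord_fun f Y -> exists a, canonical_rank Y D f a.
Proof.
  intros Hf. pose proof (ord_bound Hf) as oB.
  destruct (rank_function_exists dfn_lt_mod (hwf oB)) as (r & Hr).
  exists (app r f), (bound Y f), r. split; [exact oB|]. split; [|auto].
  apply in_funs, maps_bound; [apply Hf|]. intros; apply ole_refl.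
Qed.

Lemma canonical_rank_fun f a : canonical_rank Y D f a -> ord_fun f Y.
Proof. intros (B & r & oB & Hf & _). apply (maps_ord_fun oB), in_funs, Hf. Qed.

Lemma canonical_rank_ord f a : canonical_rank Y D f a -> ordinal a.
Proof.
  intros (B & r & oB & Hf & Hr & ->). exact (rank_function_ord dfn_lt_mod (hwf oB) Hr Hf Hf).
Qed.

Lemma clip_funs B f g : ordinal B -> mem f (funs Y B) -> ord_fun g Y -> lt_mod Y D g f ->
  exists h, mem h (funs Y B) /\ lt_mod Y D h f /\ le_mod Y D g h.
Proof.
  intros oB Hf Hg H. apply in_funs in Hf. pose proof (maps_ord_fun oB Hf) as of.
  destruct (clip hD of Hg H) as (h & Hh & K & L & M & _). exists h. split; [|auto].
  apply in_funs, maps_app. split; [apply Hh|]. intros s Hs. apply maps_app in Hf.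
  apply (ole_lt_trans oB (K s Hs)). apply Hf, Hs.
Qed.

(** Ranks computed below different bounds are compared by induction on the larger
    one: a function below [g] is moved, modulo [D], to one below [f] within the bound
    of [f]. *)
Lemma canonical_rank_mono a : ordinal a -> forall f g b, canonical_rank Y D f a ->
  canonical_rank Y D g b -> le_mod Y D g f -> ole b a.
Proof.
  pose proof canonical_rank_definable as dC. revert a.
  refine (@ord_ind _ _ (fun a => forall f g b, canonical_rank Y D f a ->
    canonical_rank Y D g b -> le_mod Y D g f -> ole b a) _ _); [dfn_solve|cbv beta].
  intros a oa IH f g b Ha Hb H.
  pose proof (canonical_rank_fun Ha) as Of. pose proof (canonical_rank_fun Hb) as Og.
  destruct Ha as (B & r & oB & Hf & Hr & Ea), Hb as (B' & r' & oB' & Hg & Hr' & ->).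
  apply (rank_function_le dfn_lt_mod (hwf oB') Hr' Hg oa).
  intros h Hh K. pose proof (maps_ord_fun oB' (proj1 (in_funs _ _ _) Hh)) as Oh.
  destruct (@clip_funs B f h oB Hf Oh) as (h' & Hh' & L & M).
  { exact (lt_le_mod_trans hD (proj1 Oh) (proj1 Og) Of K H). }
  pose proof (rank_function_lt dfn_lt_mod (hwf oB) Hr Hf Hh' L) as Lt. rewrite <- Ea in Lt.
  refine (ole_lt_trans oa (IH _ Lt h' h _ _ _ M) Lt); [exists B, r|exists B', r']; auto.
Qed.

Lemma canonical_rank_unique f a b : canonical_rank Y D f a -> canonical_rank Y D f b -> a = b.
Proof.
  intros Ha Hb. pose proof (canonical_rank_ord Ha) as oa. pose proof (canonical_rank_ord Hb) as ob.
  pose proof (le_mod_refl hD (proj1 (canonical_rank_fun Ha))) as Hf.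
  apply ole_antisym; [exact ob| |].
  - exact (canonical_rank_mono ob Hb Ha Hf).
  - exact (canonical_rank_mono oa Ha Hb Hf).
Qed.

Lemma canonical_rank_is_rank : is_rank Y D (canonical_rank Y D).
Proof.
  split; [apply (dfn_definable2 Y), canonical_rank_definable|]. intros f a. split.
  - intros Ha. split; [exact (canonical_rank_fun Ha)|].
    pose proof (canonical_rank_ord Ha) as oa. split; [exact oa|]. split.
    + intros b Hb K. rewrite (canonical_rank_unique K Ha) in Hb. exact (mem_irrefl Hb).
    + intros g Hg H. destruct (canonical_rank_total Hg) as (b & Hb). exists b. split; [|exact Hb].
      destruct Ha as (B & r & oB & Hf & Hr & Ea).
      destruct (clip_funs oB Hf Hg H) as (h & Hh & K & L).
      pose proof (rank_function_lt dfn_lt_mod (hwf oB) Hr Hf Hh K) as Lt. rewrite <- Ea in Lt.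
      refine (ole_lt_trans oa (canonical_rank_mono (ord_elem oa Lt) _ Hb L) Lt). exists B, r. auto.
  - intros (Hf & oa & Na & Ha). destruct (canonical_rank_total Hf) as (b & Hb).
    pose proof (canonical_rank_ord Hb) as ob.
    destruct (ord_trichotomy oa ob) as [K|[->|K]]; [|exact Hb|destruct (Na b K Hb)].
    exfalso. destruct Hb as (B & r & oB & HfB & Hr & ->).
    rewrite (proj2 (proj2 (proj2 Hr)) f HfB) in K. apply (in_rank_step _ dfn_lt_mod) in K.
    destruct K as (g & [Hg L] & M).
    assert (Rg : canonical_rank Y D g (app r g)) by (exists B, r; auto).
    destruct (Ha g (canonical_rank_fun Rg) L) as (c & Hc & Rc).
    rewrite (canonical_rank_unique Rc Rg) in Hc. exact (ole_not_lt (canonical_rank_ord Rg) M Hc).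
Qed.

Lemma rank_total (R : V -> V -> Prop) f : is_rank Y D R -> ord_fun f Y -> exists a, R f a.
Proof.
  intros hR Hf. destruct (canonical_rank_total Hf) as (a & Ha). exists a.
  apply (is_rank_unique canonical_rank_is_rank hR), Ha.
Qed.

End RankExistence.

(** * Iterated ranks *)

Section Commute.
Context {V : set_structure} {hZF : ZF V}.
Context (Y D : V) (R : V -> V -> Prop) (hD : filter_on Y D) (hR : is_rank Y D R).
Context (Z E : V) (Q : V -> V -> Prop) (hE : ultrafilter_on Z E) (hQ : is_rank Z E Q).
Context (totR : forall f, ord_fun f Y -> exists a, R f a).
Context (totQ : forall f, ord_fun f Z -> exists a, Q f a).
Context (k : V) (ok : ordinal k) (hk : complete_filter Z E k) (hYk : mem Y k).
Context (hAC : AC_on Z).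

(** Choice over [Z] of witnesses to the absence of holes.  Clipping confines the
    candidates for each [t] to a set; where nothing is prescribed the row [M t] is
    kept. *)
Lemma rank_choice (M h H : V) : is_fun M Z -> (forall t, mem t Z -> R (app M t) (app h t)) ->
  exists N, is_fun N Z /\ (forall t, mem t Z -> ord_fun (app N t) Y) /\
    forall t, mem t Z -> mem (app H t) (app h t) ->
      lt_mod Y D (app N t) (app M t) /\ R (app N t) (app H t).
Proof.
  intros HM Hh. pose proof (proj1 hR) as dR.
  assert (Of : forall t, mem t Z -> ord_fun (app M t) Y) by (intros t Ht; exact (rank_fun hR (Hh t Ht))).
  set (good t g := mem (app H t) (app h t) /\ lt_mod Y D g (app M t) /\ R g (app H t) \/
                     ~ mem (app H t) (app h t) /\ g = app M t).
  set (F t := sep (funs Y (bound Y (app M t))) (good t)).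
  assert (DF : dterm (fun rho => F (rho 0))) by (unfold F, good, funs, product, bound, ssup; dfn_solve).
  assert (HF : forall t g, mem g (F t) <-> mem g (funs Y (bound Y (app M t))) /\ good t g)
    by (intros t g; unfold F; rewrite in_sep by (unfold good; dfn_solve); tauto).
  destruct (hAC (lam_fun Z DF)) as (N & HN & K).
  { intros t a Ha. apply (val_lam _ _ _ DF) in Ha. destruct Ha as [Ht ->].
    intros Emp. destruct (classic (mem (app H t) (app h t))) as [L|L].
    - destruct (rank_no_hole hD hR (Hh t Ht) L) as (g & Hg & Hgf & Rg).
      destruct (clip hD (Of t Ht) Hg Hgf) as (g' & Hg' & B1 & B2 & B3 & B4).
      destruct (totR Hg') as (b & Hb).
      assert (b = app H t) as ->.
      { apply ole_antisym; [exact (rank_ord hR Rg)| |].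
        - exact (rank_mono hD hR Hb Rg B4).
        - exact (rank_mono hD hR Rg Hb B3). }
      apply (Emp g'). apply HF. split; [|left; auto].
      apply in_funs, maps_bound; [apply Hg'|exact B1].
    - apply (Emp (app M t)). apply HF. split; [|right; auto].
      apply in_funs, maps_bound; [apply (Of t Ht)|]. intros; apply ole_refl. }
  assert (HN' : forall t, mem t Z -> mem (app N t) (F t)).
  { intros t Ht. apply (K t (F t)); [apply val_lam; auto|exact (app_val HN Ht)]. }
  exists N. split; [exact HN|]. split.
  - intros t Ht. pose proof (proj1 (proj1 (HF _ _) (HN' t Ht))) as L.
    exact (maps_ord_fun (ord_bound (Of t Ht)) (proj1 (in_funs _ _ _) L)).
  - intros t Ht L. destruct (proj2 (proj1 (HF _ _) (HN' t Ht))) as [[_ J]|[J _]]; [exact J|tauto].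
Qed.

Definition column (M s : V) : V := lam Z (fun t => app (app M t) s).

Lemma column_fun (M s : V) : is_fun (column M s) Z.
Proof. apply lam_fun. dfn_solve. Qed.

Lemma app_column (M s t : V) : mem t Z -> app (column M s) t = app (app M t) s.
Proof. intros Ht. unfold column. rewrite app_lam by (auto || dfn_solve). reflexivity. Qed.

(** Replacing every row [M t] by a smaller function [N t] whose rank is prescribed
    makes almost all columns smaller: since [E] is an ultrafilter complete for [Y],
    the set of places where [N t] is below [M t] is the same for [E]-almost all [t].
    So an ordinal below the left hand side yields a matrix with
    smaller right hand side, and induction applies. *)
Lemma rank_rank_le (a : V) : ordinal a -> forall M u h c,
  is_fun M Z -> R u a -> (forall s, mem s Y -> Q (column M s) (app u s)) ->
  (forall t, mem t Z -> R (app M t) (app h t)) -> Q h c -> ole c a.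
Proof.
  pose proof (proj1 hR) as dR. pose proof (proj1 hQ) as dQ. revert a.
  refine (@ord_ind _ _ (fun a => forall M u h c,
    is_fun M Z -> R u a -> (forall s, mem s Y -> Q (column M s) (app u s)) ->
    (forall t, mem t Z -> R (app M t) (app h t)) -> Q h c -> ole c a) _ _);
    [unfold column; dfn_solve|cbv beta].
  intros a oa IH M u h c HM Ru Hu Hh Qh.
  pose proof (proj1 hE) as fE. pose proof (rank_ord hQ Qh) as oc.
  destruct (ole_or_lt oc oa) as [G|G]; [exact G|exfalso].
  destruct (rank_no_hole fE hQ Qh G) as (H & HH & HHh & QH).
  destruct (rank_choice H HM Hh) as (N & HN & ON & KN).
  apply (lt_mod_app E (proj1 HH) (proj1 (rank_fun hQ Qh))) in HHh.
  set (h' := lam Z (fun t => the (R (app N t)))).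
  assert (Dh : dterm (fun rho => the (R (app N (rho 0))))) by dfn_solve.
  assert (Hh' : forall t, mem t Z -> R (app N t) (app h' t)).
  { intros t Ht. unfold h'. rewrite app_lam by assumption. apply the_sat.
    - exact (totR (ON t Ht)).
    - intros y z. apply (rank_unique hR). }
  assert (Oh' : ord_fun h' Z).
  { apply ord_fun_app. split; [apply lam_fun, Dh|]. intros t Ht. exact (rank_ord hR (Hh' t Ht)). }
  assert (ONc : forall s, mem s Y -> ord_fun (column N s) Z).
  { intros s Hs. apply ord_fun_app. split; [apply column_fun|]. intros t Ht.
    rewrite app_column by exact Ht. exact (proj2 (proj1 (ord_fun_app _ _) (ON t Ht)) s Hs). }
  set (u' := lam Y (fun s => the (Q (column N s)))).
  assert (Du : dterm (fun rho => the (Q (column N (rho 0))))) by (unfold column; dfn_solve).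
  assert (Hu' : forall s, mem s Y -> Q (column N s) (app u' s)).
  { intros s Hs. unfold u'. rewrite app_lam by assumption. apply the_sat.
    - exact (totQ (ONc s Hs)).
    - intros y z. apply (rank_unique hQ). }
  assert (Ou' : ord_fun u' Y).
  { apply ord_fun_app. split; [apply lam_fun, Du|]. intros s Hs. exact (rank_ord hQ (Hu' s Hs)). }
  (* The uniform set of places where the rows decrease. *)
  set (A s := for_D_most Z E (fun t => mem (app (app N t) s) (app (app M t) s))).
  assert (DA : dfn (fun rho => A (rho 0))) by (unfold A; dfn_solve).
  assert (Unif : for_D_most Z E (fun t => forall s, mem s Y ->
                   (mem (app (app N t) s) (app (app M t) s) <-> A s))).
  { apply (@complete_most _ _ Z E k Y
      (fun s t => mem (app (app N t) s) (app (app M t) s) <-> A s)); [exact hk|exact ok|exact hYk|dfn_solve|].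
    intros s Hs.
    destruct (@most_ultra _ _ Z E (fun t => mem (app (app N t) s) (app (app M t) s)) hE) as [K|K];
      [dfn_solve| |].
    - refine (most_impl fE _ K _); [dfn_solve|]. intros t Ht L. fold (A s) in K. tauto.
    - refine (most_impl fE _ K _); [dfn_solve|]. intros t Ht L. split; [tauto|]. intros J.
      destruct (most_ex fE (most_and fE K J)) as (t' & _ & K1 & K2). tauto. }
  destruct (most_ex fE (most_and fE Unif HHh)) as (t0 & Ht0 & U0 & L0).
  destruct (KN t0 Ht0 L0) as [Lt0 _].
  apply (lt_mod_app D (proj1 (ON t0 Ht0)) (proj1 (rank_fun hR (Hh t0 Ht0)))) in Lt0.
  assert (Lu : lt_mod Y D u' u).
  { apply lt_mod_app; [apply Ou'|apply (rank_fun hR Ru)|].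
    refine (most_impl hD _ Lt0 _); [dfn_solve|]. intros s Hs K.
    apply (rank_lt hQ (Hu s Hs) (Hu' s Hs)). apply lt_mod_app; try apply column_fun.
    apply (U0 s Hs) in K. unfold A in K. refine (most_impl fE _ K _); [unfold column; dfn_solve|].
    intros t Ht. rewrite !app_column by exact Ht. auto. }
  destruct (totR Ou') as (b & Hb). pose proof (rank_lt hR Ru Hb Lu) as Hba.
  destruct (totQ Oh') as (c' & Hc').
  pose proof (IH b Hba N u' h' c' HN Hb Hu' Hh' Hc') as Hcb.
  assert (Hac : ole a c').
  { apply (rank_mono fE hQ QH Hc'). apply le_mod_app; [apply HH|apply Oh'|].
    refine (most_impl fE _ HHh _); [dfn_solve|]. intros t Ht L. right.
    exact (rank_unique hR (proj2 (KN t Ht L)) (Hh' t Ht)). }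
  exact (ole_not_lt (rank_ord hR Hb) (ole_trans (rank_ord hR Hb) Hac Hcb) Hba).
Qed.

(** The matrix with all rows equal to [f] has constant columns; if their ranks are
    the values of [f] again, both sides of [rank_rank_le] are explicit. *)
Lemma rank_const_fixed (f z c : V) : R f z ->
  (forall s, mem s Y -> Q (lam Z (fun _ => app f s)) (app f s)) ->
  Q (lam Z (fun _ => z)) c -> ole c z.
Proof.
  intros Rf Hf Hc. set (M := lam Z (fun _ => f)).
  assert (HM : is_fun M Z) by (apply lam_fun; dfn_solve).
  assert (EM : forall t, mem t Z -> app M t = f) by (intros t Ht; unfold M; rewrite app_lam by (auto || dfn_solve); reflexivity).
  apply (@rank_rank_le z (rank_ord hR Rf) M f (lam Z (fun _ => z)) c HM Rf); [| |exact Hc].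
  - intros s Hs. replace (column M s) with (lam Z (fun _ => app f s)); [auto|].
    apply (@fun_ext _ _ _ _ Z); [apply lam_fun; dfn_solve|apply column_fun|].
    intros t Ht. rewrite app_column, app_lam, EM by (auto || dfn_solve). reflexivity.
  - intros t Ht. rewrite EM, app_lam by (auto || dfn_solve). exact Rf.
Qed.

End Commute.

(** * Cofinality and the sequence of measurable cardinals *)

Section KappaSequence.
Context {V : set_structure} {hZF : ZF V}.
Context (mu cfmu kap : V).
Context (hmu : singular_cardinal mu).
Context (hsup : is_sup (fun l : V => mem l mu /\ measurable l) mu).
Context (hcf : is_cf mu cfmu).
Context (hkap : kappa_sequence mu cfmu kap).

Lemma mu_ord : ordinal mu.
Proof. apply hmu. Qed.

(** If [mu] were [x + 1], then [x] would bound the cardinals with supremum [mu]. *)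
Lemma mu_succ x : mem x mu -> mem (succ x) mu.
Proof.
  intros Hx. pose proof mu_ord as om. pose proof (ord_elem om Hx) as ox.
  destruct (succ_ole ox om Hx) as [K|K]; [exact K|exfalso].
  refine (ole_not_lt ox _ Hx). apply hsup; [exact ox|].
  intros l [Hl _]. rewrite <- K in Hl. apply lt_succ_ole, Hl.
Qed.

Lemma cf_ord : ordinal cfmu.
Proof. apply hcf. Qed.

Lemma cf_empty : mem empty cfmu.
Proof.
  destruct hmu as (_ & (w & Hw & Hwm) & _).
  destruct (is_empty_not (proj1 (proj2 (proj1 (proj2 Hw))))) as (x & Hx).
  destruct hcf as (oc & (h & Hh & Hc) & _).
  destruct (Hc x (lt_ole_trans mu_ord Hx Hwm)) as (i & y & Hi & _).
  apply (val_dom (proj1 Hh)) in Hi.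
  destruct (ord_trichotomy ord_empty oc) as [K|[K|K]]; [exact K| |destruct (empty_spec K)].
  rewrite <- K in Hi. destruct (empty_spec Hi).
Qed.

(** If the cofinality were [i + 1], a cofinal map could be restricted to [i]. *)
Lemma cf_succ i : mem i cfmu -> mem (succ i) cfmu.
Proof.
  intros Hi. pose proof cf_ord as oc. pose proof (ord_elem oc Hi) as oi. pose proof mu_ord as om.
  destruct (succ_ole oi oc Hi) as [K|K]; [exact K|exfalso].
  destruct hcf as (_ & (h & Hh & Hc) & L). apply maps_app in Hh. destruct Hh as [Hh Mh].
  apply (L i Hi). exists (lam i (fun j => app h j)).
  assert (Dh : dterm (fun rho => app h (rho 0))) by dfn_solve.
  assert (Sub : forall j, mem j i -> mem j cfmu) by (intros j Hj; exact (ord_trans oc Hj Hi)).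
  split.
  - apply maps_app. split; [apply lam_fun, Dh|]. intros j Hj. rewrite app_lam by assumption. auto.
  - intros x Hx. apply NNPP. intros N.
    assert (Nx : forall j, mem j i -> mem (app h j) x).
    { intros j Hj. destruct (ole_or_lt (ord_elem om Hx) (ord_elem om (Mh j (Sub j Hj)))) as [G|G]; [|exact G].
      destruct N. exists j, (app h j). split; [apply val_lam; auto|exact G]. }
    destruct (ord_max (ord_elem om Hx) (ord_elem om (Mh i Hi))) as (m & Em & M1 & M2).
    assert (Hm : mem m mu) by (destruct Em as [->| ->]; auto).
    pose proof (ord_elem om Hm) as oM.
    destruct (Hc (succ m) (mu_succ Hm)) as (j & y & Hj & Hy).
    apply (val_app _ _ Hh) in Hj. destruct Hj as [Hj ->].
    assert (Hjm : ole (app h j) m).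
    { rewrite <- K in Hj. apply in_succ in Hj. destruct Hj as [Hj| ->]; [|exact M2].
      left. exact (lt_ole_trans oM (Nx j Hj) M1). }
    refine (ole_not_lt oM (ole_trans oM Hy Hjm) _). apply lt_succ_ole, ole_refl.
Qed.

Lemma kap_val i : mem i cfmu -> val kap i (app kap i).
Proof. exact (app_val (ks_fun hkap)). Qed.

Lemma kap_lt i j : mem i j -> mem j cfmu -> mem (app kap i) (app kap j).
Proof.
  intros Hi Hj. apply (ks_increasing hkap Hi); apply kap_val; [|exact Hj].
  exact (ord_trans cf_ord Hi Hj).
Qed.

Lemma kap_mu i : mem i cfmu -> mem (app kap i) mu.
Proof.
  intros Hi. pose proof (cf_succ Hi) as Hs.
  apply (@lt_ole_trans _ _ (app kap (succ i)) mu mu_ord).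
  - apply kap_lt; [apply lt_succ_ole, ole_refl|exact Hs].
  - apply (ks_limit hkap). exists (succ i). apply kap_val, Hs.
Qed.

Lemma kap_cardinal i : mem i cfmu -> cardinal (app kap i).
Proof.
  intros Hi. pose proof (kap_val Hi) as K. destruct (classic (limit_ordinal i)) as [L|L].
  - destruct (ks_at_limit hkap K L) as (s & _ & H). apply H.
  - destruct (ks_at_nonlimit hkap K L) as [H _]. exact H.
Qed.

Lemma kap_above x : mem x mu -> exists i, mem i cfmu /\ mem x (app kap i).
Proof.
  intros Hx. pose proof mu_ord as om. pose proof (ord_elem om Hx) as ox.
  apply NNPP. intros N. refine (ole_not_lt ox _ Hx). apply (ks_limit hkap); [exact ox|].
  intros k (i & Hi). apply (val_app _ _ (ks_fun hkap)) in Hi. destruct Hi as [Hi ->].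
  destruct (ole_or_lt (ord_elem om (kap_mu Hi)) ox) as [K|K]; [exact K|]. destruct N. eauto.
Qed.

(** A larger cardinal is found among the [kappa_i]; the least one is the successor. *)
Lemma card_succ_exists x : mem x mu -> exists l, card_succ x l.
Proof.
  intros Hx. destruct (kap_above Hx) as (i & Hi & H).
  pose proof (kap_cardinal Hi) as C.
  destruct (@least_exists _ _ (fun c => cardinal c /\ mem x c) (app kap i)) as (l & Hl & _);
    [dfn_solve|apply C|auto|]. exists l. exact Hl.
Qed.

Lemma card_succ_kap_le i j l : mem i j -> mem j cfmu -> card_succ (app kap i) l -> ole l (app kap j).
Proof.
  intros Hi Hj Hl. pose proof (kap_cardinal Hj) as C.
  apply (least_ole Hl); [apply C|]. split; [exact C|]. apply kap_lt; assumption.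
Qed.

Lemma succ_not_limit (i : V) : ~ limit_ordinal (succ i).
Proof. intros (_ & _ & L). apply (L i). apply is_succ_eq. reflexivity. Qed.

Lemma kap_succ_measurable i : mem i cfmu -> measurable (app kap (succ i)).
Proof.
  intros Hi. exact (ks_at_nonlimit hkap (kap_val (cf_succ Hi)) (@succ_not_limit i)).
Qed.

Lemma kap_zero_measurable : measurable (app kap empty).
Proof.
  apply (ks_at_nonlimit hkap (kap_val cf_empty)). intros (_ & N & _). exact (N empty_spec).
Qed.

Lemma kap_zero_le i : mem i cfmu -> ole (app kap empty) (app kap i).
Proof.
  intros Hi. destruct (ord_trichotomy ord_empty (ord_elem cf_ord Hi)) as [K|[<-|K]].
  - left. apply kap_lt; assumption.
  - apply ole_refl.
  - destruct (empty_spec K).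
Qed.

(** ** Ideals dual to non-principal complete ultrafilters *)

Lemma complete_filter_le (Y D k l : V) : ordinal k -> ole l k ->
  complete_filter Y D k -> complete_filter Y D l.
Proof.
  intros ok Hl H S HS (a & Ha & Ea). apply H; [exact HS|]. exists a.
  split; [exact (lt_ole_trans ok Ha Hl)|exact Ea].
Qed.

Lemma nonprincipal_most_ne (Y D : V) : ultrafilter_on Y D -> ~ principal_filter Y D ->
  forall x, mem x Y -> for_D_most Y D (fun y => y <> x).
Proof.
  intros U N x Hx. pose proof (proj1 U) as F.
  destruct (@most_ultra _ _ Y D (fun y => y = x) U) as [K|K]; [dfn_solve| |exact K].
  destruct N. exists (upair x x).
  assert (Sx : forall A, subset (upair x x) A <-> mem x A).
  { intros A. split; [intros H; apply H, in_upair; auto|].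
    intros H y Hy. apply in_upair in Hy. destruct Hy as [->| ->]; exact H. }
  split; [apply Sx, Hx|]. intros X. rewrite Sx. split.
  - intros HX. split; [apply F, HX|].
    assert (L : for_D_most Y D (fun y => mem y X)).
    { exists X. split; [exact HX|]. intros s. split; [|tauto]. intros Hs.
      split; [exact (proj1 F X HX s Hs)|exact Hs]. }
    destruct (most_ex F (most_and F K L)) as (y & _ & -> & H). exact H.
  - intros [HX Hx']. destruct K as (A & HA & K). destruct F as (_ & _ & _ & M & _).
    apply (M A); [exact HA| |exact HX]. intros y Hy. apply K in Hy. destruct Hy as [_ ->]. exact Hx'.
Qed.

(** The complements of the points of [Y] have empty intersection. *)
Lemma nonprincipal_incomplete (Y D l : V) : ultrafilter_on Y D -> ~ principal_filter Y D ->
  ordinal l -> mem Y l -> ~ complete_filter Y D l.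
Proof.
  intros U N ol HY C.
  pose proof (@complete_most _ _ Y D l Y (fun j y => y <> j) C ol HY) as K.
  destruct (@most_ex _ Y D (proj1 U) _ (K ltac:(dfn_solve) (nonprincipal_most_ne U N)))
    as (y & Hy & H).
  exact (H y Hy eq_refl).
Qed.

Definition diff (Y X : V) : V := sep Y (fun y => ~ mem y X).

Lemma in_diff Y X y : mem y (diff Y X) <-> mem y Y /\ ~ mem y X.
Proof. unfold diff. rewrite in_sep by dfn_solve. tauto. Qed.

Lemma is_diff_eq Y X Z : is_diff Y X Z <-> Z = diff Y X.
Proof.
  split.
  - intros H. apply extensionality. intros y. rewrite in_diff. apply H.
  - intros -> y. apply in_diff.
Qed.

Lemma diff_diff Y X : subset X Y -> diff Y (diff Y X) = X.
Proof.
  intros H. apply extensionality. intros y. rewrite !in_diff. split.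
  - intros [Hy N]. apply NNPP. tauto.
  - intros Hy. split; [auto|tauto].
Qed.

(** Over a non-principal ultrafilter every singleton lies in the dual ideal, so the
    ideal determines its underlying set. *)
Lemma kappa_ideal_union J k D : kappa_ideal mu kap J k D -> k = union J.
Proof.
  intros (_ & _ & I & du & U & N & _). apply extensionality. intros x. rewrite in_union. split.
  - intros Hx. apply (nonprincipal_most_ne U N) in Hx as K. destruct K as (A & HA & K).
    apply du in HA. destruct HA as (X & HX & HA). exists X. split; [exact HX|].
    apply NNPP. intros NX. assert (HxA : mem x A) by (apply HA; auto).
    apply K in HxA. tauto.
  - intros (X & HX & Hx). destruct I as [I _]. exact (I X HX x Hx).
Qed.

Lemma kappa_ideal_unique J k D k' D' : kappa_ideal mu kap J k D -> kappa_ideal mu kap J k' D' ->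
  k' = k /\ D' = D.
Proof.
  intros H H'. assert (E : k' = k) by (rewrite (kappa_ideal_union H); exact (kappa_ideal_union H')).
  subst k'. split; [reflexivity|]. apply extensionality. intros Z.
  destruct H as (_ & _ & _ & d & _), H' as (_ & _ & _ & d' & _). rewrite (d Z), (d' Z). tauto.
Qed.

Lemma kappa_ideal_ultra J k D : kappa_ideal mu kap J k D -> ultrafilter_on k D.
Proof. unfold kappa_ideal. tauto. Qed.

Lemma complete_ideal_iff J k D l : kappa_ideal mu kap J k D ->
  (complete_ideal k J l <-> complete_filter k D l).
Proof.
  intros (_ & _ & _ & d & _). split.
  - intros (D' & d' & H). replace D with D'; [exact H|].
    apply extensionality. intros Z. rewrite (d Z), (d' Z). tauto.
  - intros H. exists D. auto.
Qed.

Lemma incomplete_at_iff J k D i l : kappa_ideal mu kap J k D -> mem i cfmu ->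
  card_succ (app kap (succ i)) l -> (incomplete_at kap k J i <-> ~ complete_filter k D l).
Proof.
  intros H Hi Hl. unfold incomplete_at. setoid_rewrite (complete_ideal_iff _ H). split.
  - intros (i1 & m & m' & Hi1 & Hm & Hm' & N). apply is_succ_eq in Hi1. subst i1.
    apply (val_app _ _ (ks_fun hkap)) in Hm. destruct Hm as [_ ->].
    rewrite (least_unique Hl Hm'). exact N.
  - intros N. exists (succ i), (app kap (succ i)), l.
    split; [apply is_succ_eq; reflexivity|]. split; [apply kap_val, cf_succ, Hi|auto].
Qed.

Lemma incomplete_at_dom J k i : incomplete_at kap k J i -> ordinal i -> mem i cfmu.
Proof.
  intros (i1 & l & _ & Hi1 & Hl & _) oi. apply is_succ_eq in Hi1. subst i1.
  apply (val_dom (ks_fun hkap)) in Hl.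
  apply (ord_trans cf_ord (b := succ i)); [|exact Hl]. apply lt_succ_ole, ole_refl.
Qed.

Lemma dfn_incomplete_at k J : dfn (fun rho => incomplete_at kap k J (rho 0)).
Proof. unfold incomplete_at. dfn_solve. Qed.

(** An index exists because an ideal on [k] is not complete beyond [k], and some
    [kappa_i] exceeds [k]. *)
Lemma incompleteness_exists J k D : kappa_ideal mu kap J k D ->
  exists i, least (incomplete_at kap k J) i.
Proof.
  intros H. pose proof H as (_ & Hk & _ & _ & U & N & _).
  destruct (kap_above Hk) as (i & Hi & Hki). pose proof (cf_succ Hi) as Hs.
  destruct (card_succ_exists (kap_mu Hs)) as (l & Hl).
  pose proof Hl as (ol & [_ L] & _).
  destruct (least_exists (dfn_incomplete_at k J) (ord_elem cf_ord Hi)) as (j & Hj & _); [|eauto].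
  apply (incomplete_at_iff H Hi Hl). apply (nonprincipal_incomplete U N ol).
  apply (ord_trans ol (b := app kap (succ i))); [|exact L].
  apply (ord_trans (proj1 (kap_cardinal Hs)) Hki). apply kap_lt; [apply lt_succ_ole, ole_refl|exact Hs].
Qed.

(** If [x] belongs to [kappa_i], an index above [i] forces completeness at the
    successor of [kappa_(i+1)]. *)
Lemma index_complete x : mem x mu -> exists i, mem i cfmu /\
  forall J k D n, kappa_ideal mu kap J k D -> least (incomplete_at kap k J) n -> ole i n ->
  exists l, ordinal l /\ mem x l /\ complete_filter k D l.
Proof.
  intros Hx. destruct (kap_above Hx) as (i & Hi & Hxi). pose proof (cf_succ Hi) as Hs.
  exists (succ i). split; [exact Hs|]. intros J k D n H (on & _ & Ln) Hin.
  destruct (card_succ_exists (kap_mu Hs)) as (l & Hl).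
  pose proof Hl as (ol & [_ L] & _).
  exists l. split; [exact ol|]. split.
  - apply (ord_trans ol (b := app kap (succ i))); [|exact L].
    apply (ord_trans (proj1 (kap_cardinal Hs)) Hxi). apply kap_lt; [apply lt_succ_ole, ole_refl|exact Hs].
  - apply NNPP. intros N. apply (Ln i).
    + apply (lt_ole_trans on (b := succ i)); [apply lt_succ_ole, ole_refl|exact Hin].
    + apply (incomplete_at_iff H Hi Hl), N.
Qed.

Lemma omega_complete J k D : kappa_ideal mu kap J k D ->
  exists w l, is_omega w /\ mem w l /\ ordinal l /\ complete_filter k D l.
Proof.
  intros (_ & _ & _ & _ & _ & _ & z & l & Hz & Hl & C).
  rewrite (empty_unique Hz empty_spec) in Hl. apply (val_app _ _ (ks_fun hkap)) in Hl.
  destruct Hl as [_ ->]. destruct kap_zero_measurable as (Cl & (w & Hw & Hwk) & _).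
  exists w, (app kap empty). split; [exact Hw|]. split; [exact Hwk|]. split; [apply Cl|exact C].
Qed.

Definition dual_ideal (k D : V) : V := sep (power k) (fun X => mem (diff k X) D).

Lemma in_dual_ideal k D X : mem X (dual_ideal k D) <-> subset X k /\ mem (diff k X) D.
Proof. unfold dual_ideal. rewrite in_sep by (unfold diff; dfn_solve). rewrite in_power. tauto. Qed.

Lemma dual_ideal_spec k D : filter_on k D -> ideal_on k (dual_ideal k D) /\ is_dual k (dual_ideal k D) D.
Proof.
  intros (F1 & F2 & F3 & F4 & F5). split.
  - repeat split.
    + intros X HX. apply in_dual_ideal in HX. tauto.
    + intros X HX. apply in_dual_ideal. split; [intros y Hy; destruct (HX y Hy)|].
      replace (diff k X) with k; [exact F2|]. apply extensionality. intros y. rewrite in_diff.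
      specialize (HX y). tauto.
    + intros H. apply in_dual_ideal in H. apply (F3 (diff k k)); [|tauto].
      intros y Hy. apply in_diff in Hy. tauto.
    + intros X Z HX HZ. apply in_dual_ideal in HX. destruct HX as [HX1 HX2]. apply in_dual_ideal.
      split; [intros y Hy; auto|]. apply (F4 (diff k X)); [exact HX2| |].
      * intros y. rewrite !in_diff. intros [Hy N]. split; [exact Hy|]. auto.
      * intros y Hy. apply in_diff in Hy. tauto.
    + intros X Z HX HZ. apply in_dual_ideal in HX, HZ.
      destruct (F5 _ _ (proj2 HX) (proj2 HZ)) as (I & HI & K).
      assert (HIk : subset I k) by (intros y Hy; apply K in Hy; rewrite in_diff in Hy; tauto).
      exists (diff k I). split.
      * apply in_dual_ideal. split; [intros y Hy; apply in_diff in Hy; tauto|].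
        rewrite diff_diff by exact HIk. exact HI.
      * intros y. rewrite in_diff, K, !in_diff. destruct HX as [HX _], HZ as [HZ _].
        specialize (HX y). specialize (HZ y). tauto.
  - intros Z. split.
    + intros HZ. exists (diff k Z). split; [|apply is_diff_eq; symmetry; apply diff_diff; auto].
      apply in_dual_ideal. split; [intros y Hy; apply in_diff in Hy; tauto|].
      rewrite diff_diff; auto.
    + intros (X & HX & HZ). apply is_diff_eq in HZ. subst Z. apply in_dual_ideal in HX. tauto.
Qed.

(** The dual of a measure on [kappa_(i+1)] is complete at the successor of
    [kappa_(j+1)] for [j < i], as that cardinal is at most [kappa_(i+1)]; being
    non-principal, the measure is not complete at the successor of [kappa_(i+1)]. *)
Lemma index_attained i : mem i cfmu ->
  exists J k D, kappa_ideal mu kap J k D /\ least (incomplete_at kap k J) i.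
Proof.
  intros Hi. pose proof (cf_succ Hi) as Hs.
  destruct (kap_succ_measurable Hi) as (C & _ & D & U & N & HC).
  set (k := app kap (succ i)) in *. destruct (dual_ideal_spec (proj1 U)) as [I d].
  assert (H : kappa_ideal mu kap (dual_ideal k D) k D).
  { split; [exact C|]. split; [apply kap_mu, Hs|]. split; [exact I|]. split; [exact d|].
    split; [exact U|]. split; [exact N|]. exists empty, (app kap empty).
    split; [apply empty_spec|]. split; [apply kap_val, cf_empty|].
    apply (complete_filter_le (proj1 C) (kap_zero_le Hs) HC). }
  exists (dual_ideal k D), k, D. split; [exact H|].
  split; [exact (ord_elem cf_ord Hi)|]. split.
  - destruct (card_succ_exists (kap_mu Hs)) as (l & Hl). apply (incomplete_at_iff H Hi Hl).
    destruct Hl as (ol & [_ L] & _). exact (nonprincipal_incomplete U N ol L).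
  - intros j Hj. assert (Hjc : mem j cfmu) by exact (ord_trans cf_ord Hj Hi).
    pose proof (cf_succ Hjc) as Hsj.
    destruct (card_succ_exists (kap_mu Hsj)) as (l & Hl). rewrite (incomplete_at_iff H Hjc Hl).
    intros K. apply K. refine (complete_filter_le (proj1 C) _ HC). unfold k.
    refine (card_succ_kap_le _ Hs Hl). apply lt_succ_ole.
    apply succ_ole; [exact (ord_elem cf_ord Hjc)|exact (ord_elem cf_ord Hi)|exact Hj].
Qed.

End KappaSequence.

(** * The rank system of the sequence *)

Section RankSystem.
Context {V : set_structure} {hZF : ZF V}.
Context (mu cfmu kap : V).
Context (hDC : DC V) (hAC : AC_lt mu).
Context (hmu : singular_cardinal mu).
Context (hsup : is_sup (fun l : V => mem l mu /\ measurable l) mu).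
Context (hcf : is_cf mu cfmu).
Context (hkap : kappa_sequence mu cfmu kap).

Lemma kappa_ideal_well_founded J k D : kappa_ideal mu kap J k D -> well_founded_mod k D.
Proof.
  intros H. destruct (omega_complete hmu hcf hkap H) as (w & l & Hw & Hwl & ol & C).
  exact (complete_well_founded hDC (proj1 (kappa_ideal_ultra H)) C ol Hw Hwl).
Qed.

(** ** Existence *)

Lemma definable_function (A : V) (R : V -> V -> Prop) : dfn (fun rho => R (rho 0) (rho 1)) ->
  (forall x, mem x A -> exists y, R x y) -> (forall x y z, R x y -> R x z -> y = z) ->
  exists f, is_fun f A /\ forall x y, val f x y <-> mem x A /\ R x y.
Proof.
  intros HR H1 H2. assert (DF : dterm (fun rho => the (R (rho 0)))) by dfn_solve.
  exists (lam A (fun x => the (R x))). split; [exact (lam_fun A DF)|].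
  intros x y. rewrite (val_lam _ _ _ DF). split; intros [Hx E]; (split; [exact Hx|]).
  - subst y. apply the_sat; eauto.
  - symmetry. apply the_unique; eauto.
Qed.

Lemma measurable_system_exists : exists p : rank_data V, measurable_system mu kap p.
Proof.
  set (DK J := exists k D, kappa_ideal mu kap J k D).
  assert (dK : dfn (fun rho => kappa_ideal mu kap (rho 0) (rho 1) (rho 2)))
    by (unfold kappa_ideal; dfn_solve).
  assert (dK' : forall t u v, dterm t -> dterm u -> dterm v ->
            dfn (fun rho => kappa_ideal mu kap (t rho) (u rho) (v rho)))
    by (intros; apply (dfn_subst3 dK); assumption).
  set (DDs := sep (power (power mu)) DK).
  assert (HDD : forall J, mem J DDs <-> DK J).
  { intros J. unfold DDs. rewrite in_sep by (unfold DK; do 2 (apply dfn_ex; dfn_fold);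
      apply dK'; dfn_solve). rewrite in_power. split; [tauto|]. intros H. split; [|exact H].
    destruct H as (k & D & H). intros X HX. apply in_power. intros x Hx.
    pose proof (kappa_ideal_union H) as E. destruct H as (_ & Hk & _).
    apply (ord_trans (mu_ord hmu) (b := k)); [|exact Hk]. rewrite E. apply in_union. eauto. }
  destruct (@definable_function DDs (fun J k => exists D, kappa_ideal mu kap J k D))
    as (Yf & HY1 & HY2).
  { apply dfn_ex; dfn_fold; apply dK'; dfn_solve. }
  { intros J HJ. apply HDD in HJ. exact HJ. }
  { intros J k k' (D & H) (D' & H'). symmetry. apply (kappa_ideal_unique H H'). }
  destruct (@definable_function DDs (fun J D => exists k, kappa_ideal mu kap J k D))
    as (Df & HD1 & HD2).
  { apply dfn_ex; dfn_fold; apply dK'; dfn_solve. }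
  { intros J HJ. apply HDD in HJ. destruct HJ as (k & D & H). eauto. }
  { intros J D D' (k & H) (k' & H'). symmetry. apply (kappa_ideal_unique H H'). }
  destruct (@definable_function DDs (fun J i =>
    exists k D, kappa_ideal mu kap J k D /\ least (incomplete_at kap k J) i)) as (jf & Hj1 & Hj2).
  { do 2 (apply dfn_ex; dfn_fold). apply dfn_and; [apply dK'; dfn_solve|].
    unfold least, incomplete_at. dfn_solve. }
  { intros J HJ. apply HDD in HJ. destruct HJ as (k & D & H).
    destruct (incompleteness_exists hmu hsup hcf hkap H) as (i & Hi). eauto. }
  { intros J i i' (k & D & H & L) (k' & D' & H' & L').
    destruct (kappa_ideal_unique H H') as [-> _]. exact (least_unique L L'). }
  destruct (@definable_function DDs (fun J S => is_pair J J S)) as (Sf & HS1 & HS2).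
  { dfn_solve. }
  { intros J _. exists (upair J J). apply upair_spec. }
  { intros J S S' H H'. apply is_pair_eq in H, H'. congruence. }
  assert (dC : dfn (fun rho : nat -> V => canonical_rank (rho 0) (rho 1) (rho 2) (rho 3))).
  { unfold canonical_rank, functions_below, rank_function, rank_step, funs, product, ssup. dfn_solve. }
  set (rk' J f a := exists k D, kappa_ideal mu kap J k D /\ canonical_rank k D f a).
  assert (dR : dfn (fun rho => rk' (rho 0) (rho 1) (rho 2))).
  { unfold rk'. do 2 (apply dfn_ex; dfn_fold). apply dfn_and; [apply dK'; dfn_solve|].
    exact (dfn_rename (fun n => match n with 0 => 1 | 1 => 0 | 2 => 3 | _ => 4 end) dC). }
  assert (HE : forall J k D, kappa_ideal mu kap J k D -> forall f a,
                 rk' J f a <-> canonical_rank k D f a).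
  { intros J k D H f a. split; [|unfold rk'; eauto].
    intros (k' & D' & H' & K). destruct (kappa_ideal_unique H H') as [-> ->]. exact K. }
  exists (RankData DDs Yf Df rk' Sf jf mu). split; simpl; try assumption.
  - reflexivity.
  - split; [exact HY1|]. intros J k. rewrite HY2, HDD. split; [tauto|].
    intros (D & H). split; [exists k, D|exists D]; exact H.
  - split; [exact HD1|]. intros J D. rewrite HD2, HDD. split; [tauto|].
    intros (k & H). split; [exists k, D|exists k]; exact H.
  - split; [exact Hj1|]. intros J i. rewrite Hj2, HDD. split; [tauto|].
    intros (k & D & H). split; [exists k, D; apply H|eauto].
  - split; [exact HS1|exact HS2].
  - exact (dfn_definable3 mu dR).
  - intros J f a (k & D & H & _). apply HDD. exists k, D. exact H.
  - intros J k D H.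
    pose proof (canonical_rank_is_rank (proj1 (kappa_ideal_ultra H)) (kappa_ideal_well_founded H)) as [_ K].
    split.
    + apply (dfn_definable2 mu).
      exact (dfn_subst3 dR (dterm_param J) (dterm_var 0) (dterm_var 1)).
    + intros f a. rewrite (HE _ _ _ H), (K f a). setoid_rewrite (HE _ _ _ H). reflexivity.
Qed.

(** ** The axioms of strict rank systems *)

Context (p : rank_data V) (hp : measurable_system mu kap p).

Lemma Yof_ideal d Y : val (Yof p) d Y -> exists D, kappa_ideal mu kap d Y D.
Proof. apply (ms_Yof hp). Qed.

Lemma Dof_ideal d Y D : kappa_ideal mu kap d Y D -> val (Dof p) d D.
Proof. intros H. apply (ms_Dof hp). eauto. Qed.

Lemma Yof_Dof_ideal d Y D : val (Yof p) d Y -> val (Dof p) d D -> kappa_ideal mu kap d Y D.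
Proof.
  intros HY HD. destruct (Yof_ideal HY) as (D' & H). apply (ms_Dof hp) in HD.
  destruct HD as (Y' & H'). destruct (kappa_ideal_unique H H') as [_ ->]. exact H.
Qed.

Lemma in_Sig_eq d e : in_Sig p e d -> e = d.
Proof.
  intros (S & HS & He). apply (ms_Sig hp) in HS. destruct HS as [_ HS]. apply HS in He. tauto.
Qed.

Lemma in_Sig_refl d Y D : kappa_ideal mu kap d Y D -> in_Sig p d d.
Proof.
  intros H. exists (upair d d). split.
  - apply (ms_Sig hp). split; [apply (ms_DD hp); eauto|apply upair_spec].
  - apply in_upair. auto.
Qed.

Lemma rk_ideal d f a : rk p d f a -> exists Y D, kappa_ideal mu kap d Y D.
Proof. intros H. apply (ms_DD hp). exact (ms_rk_dom hp H). Qed.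

Lemma rk_total d Y D f : kappa_ideal mu kap d Y D -> ord_fun f Y -> exists a, rk p d f a.
Proof.
  intros H. apply (rank_total (proj1 (kappa_ideal_ultra H)) (kappa_ideal_well_founded H)).
  exact (ms_rk hp H).
Qed.

Lemma DD_ge_complete (x : V) : mem x mu -> exists i, mem i cfmu /\
  forall d Y D, in_DD_ge p i d -> kappa_ideal mu kap d Y D ->
  exists l, ordinal l /\ mem x l /\ complete_filter Y D l.
Proof.
  intros Hx. destruct (index_complete hmu hsup hcf hkap Hx) as (i & Hi & K).
  exists i. split; [exact Hi|]. intros d Y D [Hd (n & Hn & Hin)] H.
  apply (ms_j hp) in Hn. destruct Hn as (Y' & D' & H' & L).
  destruct (kappa_ideal_unique H H') as [-> ->]. exact (K _ _ _ _ H L Hin).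
Qed.

Lemma DD_ge_le (i j d : V) : ordinal cfmu -> mem i cfmu -> ole j i -> in_DD_ge p i d -> in_DD_ge p j d.
Proof.
  intros oc Hi Hj [Hd (n & Hn & Hin)]. split; [exact Hd|]. exists n. split; [exact Hn|].
  apply (ms_j hp) in Hn. destruct Hn as (_ & _ & _ & L & _). exact (ole_trans L Hj Hin).
Qed.

Lemma theta_lt_mu (d Y D : V) : kappa_ideal mu kap d Y D -> exists t, is_theta Y t /\ mem t mu.
Proof.
  intros (C & HY & _). destruct (kap_above hmu hsup hcf hkap HY) as (i & Hi & H).
  pose proof (kap_cardinal hkap Hi) as Ci.
  destruct (@least_exists _ _ (fun a => ~ is_empty a /\ ~ exists f, onto f Y a) (app kap i))
    as (t & Ht & Hti); [dfn_solve|apply Ci| |].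
  - split; [intros E; exact (E Y H)|]. intros (f & Hf).
    exact (no_onto_larger_cardinal (proj1 C) Ci H Hf).
  - exists t. split; [exact Ht|]. 
    exact (ole_lt_trans (mu_ord hmu) Hti (kap_mu hmu hsup hcf hkap Hi)).
Qed.

(** Otherwise the complements of all pieces are large, and so is their intersection,
    which is empty. *)
Lemma partition_piece (Y D l X A : V) : ultrafilter_on Y D -> complete_filter Y D l -> ordinal l ->
  mem X l -> is_partition A X Y -> exists j Aj, val A j Aj /\ mem Aj D.
Proof.
  intros U C ol HX (HA & Cov & _). apply NNPP. intros N. pose proof (proj1 U) as F.
  assert (K : for_D_most Y D (fun y => forall j, mem j X -> ~ mem y (app A j))).
  { apply (@complete_most _ _ Y D l X (fun j y => ~ mem y (app A j)) C ol HX); [dfn_solve|].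
    intros j Hj. destruct (@most_ultra _ _ Y D (fun y => mem y (app A j)) U) as [K|K];
      [dfn_solve| |exact K].
    destruct N. exists j, (app A j). split; [exact (app_val HA Hj)|].
    destruct K as (B & HB & K). replace (app A j) with B; [exact HB|].
    apply extensionality. intros y. rewrite K. split; [tauto|]. intros Hy. split; [|exact Hy].
    apply Cov. exists j, (app A j). split; [exact (app_val HA Hj)|exact Hy]. }
  destruct (most_ex F K) as (y & Hy & H). apply Cov in Hy. destruct Hy as (j & Aj & Hj & Hy).
  apply (val_app _ _ HA) in Hj. destruct Hj as [Hj ->]. exact (H j Hj Hy).
Qed.

Lemma weak_system : weak_rank_1_system p.
Proof.
  pose proof (ms_mu hp) as Em.
  split; rewrite ?Em.
  - exact hmu.
  - apply (ms_Yof hp).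
  - apply (ms_Dof hp).
  - intros d Y D HY HD. exact (proj1 (kappa_ideal_ultra (Yof_Dof_ideal HY HD))).
  - intros d Y HY. destruct (Yof_ideal HY) as (D & H). exact (theta_lt_mu H).
  - exact (ms_rk_definable hp).
  - intros d f a H. destruct (rk_ideal H) as (Y & D & K). exists Y.
    pose proof (ms_rk hp K) as hR. split; [|split].
    + apply (ms_Yof hp). eauto.
    + exact (rank_fun hR H).
    + exact (rank_ord hR H).
  - intros d Y f HY Hf. destruct (Yof_ideal HY) as (D & H).
    destruct (rk_total H Hf) as (a & Ha). exists a. split; [exact Ha|].
    intros b Hb. exact (rank_unique (ms_rk hp H) Ha Hb).
  - apply (ms_Sig hp).
  - intros d e H. pose proof (in_Sig_eq H) as ->. destruct H as (S & HS & _).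
    exact (val_dom (proj1 (ms_Sig hp)) HS).
  - intros d e Y H. rewrite (in_Sig_eq H). auto.
  - intros c Hc. rewrite (least_unique Hc hcf). split; [split; [apply (ms_j hp)|]|].
    + intros d i H. apply (ms_j hp) in H. destruct H as (Y & D & K & oi & L & _).
      exact (incomplete_at_dom hcf hkap L oi).
    + intros i Hi. destruct (index_attained hmu hsup hcf hkap Hi) as (J & k & D & H & L).
      exists J. apply (ms_j hp). eauto.
  - intros d e i n H. rewrite (in_Sig_eq H). intros Hi Hn.
    rewrite (val_functional (proj1 (ms_j hp)) Hi Hn). apply ole_refl.
  - intros c Hc x Hx. rewrite (least_unique Hc hcf).
    destruct (DD_ge_complete Hx) as (i & Hi & K). exists i. split; [exact Hi|].
    intros d Hd Y f z A HY Rf HA. destruct (Yof_ideal HY) as (D & H).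
    destruct (K d Y D Hd H) as (l & ol & Hxl & C).
    destruct (partition_piece (kappa_ideal_ultra H) C ol Hxl HA) as (j & Aj & Hj & HAj).
    exists d, j, Aj, D. split; [exact (in_Sig_refl H)|]. split; [exact Hj|].
    split; [exact (Dof_ideal H)|]. auto.
  - intros d f xi z Rf Hz. destruct (rk_ideal Rf) as (Y & D & H).
    destruct (rank_no_hole (proj1 (kappa_ideal_ultra H)) (ms_rk hp H) Rf Hz) as (g & Hg & L & Rg).
    exists d, g, Y, D. split; [exact (in_Sig_refl H)|].
    split; [apply (ms_Yof hp); eauto|]. split; [exact (Dof_ideal H)|]. auto.
  - intros d Y D f g a b HY HD L Ra Rb. pose proof (Yof_Dof_ideal HY HD) as H.
    apply is_succ_eq. exact (rank_succ (proj1 (kappa_ideal_ultra H)) (ms_rk hp H) L Ra Rb).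
  - intros d Y D f g a b HY HD L Ra Rb. pose proof (Yof_Dof_ideal HY HD) as H.
    exact (rank_mono (proj1 (kappa_ideal_ultra H)) (ms_rk hp H) Ra Rb L).
Qed.

Lemma is_const_lam (c Y a : V) : is_const c Y a -> c = lam Y (fun _ => a).
Proof.
  intros [Hc K]. apply (@fun_ext _ _ _ _ Y Hc); [apply lam_fun; dfn_solve|].
  intros s Hs. rewrite app_lam by (auto || dfn_solve). exact (K s _ (app_val Hc Hs)).
Qed.

Lemma strict_system : strict_rank_1_system p.
Proof.
  split; [exact weak_system|]. rewrite (ms_mu hp).
  intros c d Y f z xi j0 Hc HY oz oxi Hf Rf Hxi _ Hj0 Fix.
  rewrite (least_unique Hc hcf) in *. pose proof (cf_ord hcf) as oc.
  destruct (Yof_ideal HY) as (D & Hd). pose proof Hd as (_ & HYmu & _).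
  destruct (DD_ge_complete HYmu) as (i & Hi & K).
  destruct (ord_max (ord_elem oc Hi) (ord_elem oc Hj0)) as (j & Ej & Hij & Hj0j).
  assert (Hj : mem j cfmu) by (destruct Ej as [->| ->]; assumption).
  exists j. split; [exact Hj|]. split; [exact Hj0j|].
  intros (e & Z & g & z1 & r & He & HZ & Hg & Hz1 & Hgz & Rg & Hr).
  destruct (Yof_ideal HZ) as (E & HE). pose proof HE as (_ & HZmu & _).
  destruct (K e Z E (DD_ge_le oc Hj Hij He) HE) as (l & ol & HYl & C).
  pose proof (kappa_ideal_ultra HE) as UE. pose proof (ms_rk hp HE) as hQ.
  assert (Hcz : ord_fun (lam Z (fun _ => z)) Z) by (apply ord_fun_lam; [dfn_solve|auto]).
  destruct (rk_total HE Hcz) as (c' & Rc).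
  (* The constant [z] has [E]-rank at most [z], so [g], being below it, has smaller rank. *)
  assert (Hle : ole c' z).
  { apply (@rank_const_fixed _ _ Y D (rk p d) (proj1 (kappa_ideal_ultra Hd)) (ms_rk hp Hd)
      Z E (rk p e) UE hQ (fun h => rk_total Hd (f := h)) (fun h => rk_total HE (f := h))
      l ol C HYl (hAC HZmu) f z c' Rf); [|exact Rc].
    intros s Hs. apply maps_app in Hf as Hf'. destruct Hf' as [Ff Mf].
    destruct (Fix s (app f s) e (app_val Ff Hs) (DD_ge_le oc Hj Hj0j He)) as (Z' & b & HZ' & Hb & Rb).
    rewrite (val_functional (proj1 (ms_Yof hp)) HZ' HZ) in Hb.
    rewrite <- (is_const_lam Hb). exact Rb. }
  assert (Lt : mem r c').
  { apply (rank_lt hQ Rc Rg). apply maps_app in Hg. destruct Hg as [Fg Mg].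
    apply lt_mod_app; [exact Fg|apply Hcz|]. apply (most_all (proj1 UE)). intros t Ht.
    rewrite app_lam by (auto || dfn_solve). auto. }
  pose proof (rank_ord hQ Rc) as oc'. 
  exact (ole_not_lt (ord_elem oc' Lt) (ole_trans (ord_elem oc' Lt) Hle Hr) Lt).
Qed.

End RankSystem.

Theorem claim4p3 (V : set_structure) (mu cfmu kap : V)
  (hZF : ZF V) (hDC : DC V) (hAC : AC_lt mu)
  (hmu : singular_cardinal mu)
  (hsup : is_sup (fun l : V => mem l mu /\ measurable l) mu)
  (hcf : is_cf mu cfmu)
  (hkap : kappa_sequence mu cfmu kap) :
  (exists p : rank_data V, measurable_system mu kap p) /\
  (forall p : rank_data V, measurable_system mu kap p -> strict_rank_1_system p).
Proof.
  split.
  - exact (measurable_system_exists hDC hmu hsup hcf hkap).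
  - intros p hp. exact (strict_system hDC hAC hmu hsup hcf hkap hp).
Qed.
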